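(* Let $k,A,M,\triangledown,K$ and all complexes and maps be as in the context. Let $\widetilde{\mathfrak B}\colon\widetilde X_{vw}\to\widetilde X_{v,w+1}$ be the map defined by $\widetilde{\mathfrak B}(\mathbf x,\mathbf y):=(0,\mathbf x)$. Then $(\widetilde X,\widetilde{\mathfrak b},\widetilde{\mathfrak d}+\widetilde\xi,\widetilde{\mathfrak B})$ is a double mixed complex and the map $$\Psi\colon(\widetilde X,\widetilde{\mathfrak b},\widetilde{\mathfrak d}+\widetilde\xi,\widetilde{\mathfrak B})\longrightarrow(P(\ddot X),\ddot b,\ddot d,\ddot B),$$ defined by $$\Psi_{vw}(\mathbf x,\mathbf y):=\frac1{w+1}\bigl(\overline N(\mathbf x),\Upsilon\circ\overline N(\mathbf x)\bigr)+\bigl(0,\overline N(\mathbf y)\bigr),$$ is an isomorphism of double mixed complexes.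
   Context: **Setting.** $k$ is a commutative ring with $\mathbb Q\subseteq k$; $A$ is an associative unital $k$-algebra; $M$ is an $A$-bimodule with an associative $A$-bimodule map $\triangledown\colon M\otimes_A M\to M$; $K$ is a $k$-subalgebra of $A$; $E=A\ltimes_\triangledown M$ is the associated algebra on $A\times M$ with product $(a,m)(a',m')=(aa',am'+ma'+m\triangledown m')$. $\otimes$ means $\otimes_K$; $\overline A=A/K$, $\overline E=E/K=\overline A\oplus M$. For a $K$-bimodule $V$, $V\otimes:=V/[V,K]$, where $[V,K]$ is spanned over $k$ by all $v\lambda-\lambda v$. For $0\le w\le n$, $B^n_w\subseteq\overline E^{\otimes n}$ is spanned over $k$ by simple tensors with exactly $w$ factors in $M$ and the others in $\overline A$; $B^0_0=K$, and $B^n_w=0$ if $w<0$ or $w>n$. Always $n=v+w$. For $v,w\ge0$, $X_{vw}:=M\otimes B^n_w\otimes$; $X_{vw}:=0$ otherwise. **Maps.** Maps are given on (classes of) simple tensors $x_0\otimes\cdots\otimes x_n$ with each $x_i\in A\cup M$ (elements of $A$ in positions $\ge1$ taken modulo $K$). For $x,y\in A\cup M$, $xy$ is the product in $A$ if both are in $A$, the bimodule action if exactly one is in $M$, and $0$ if both are in $M$; $x\triangledown y$ is as given if both are in $M$ and $0$ otherwise. For $0\le j<n$, $\mu_j(x_0\otimes\cdots\otimes x_n)=(-1)^jx_0\otimes\cdots\otimes x_jx_{j+1}\otimes\cdots\otimes x_n$, $\varrho_j(x_0\otimes\cdots\otimes x_n)=(-1)^jx_0\otimes\cdots\otimes (x_j\triangledown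 x_{j+1})\otimes\cdots\otimes x_n$; $\mu_n(x_0\otimes\cdots\otimes x_n)=(-1)^nx_nx_0\otimes x_1\otimes\cdots\otimes x_{n-1}$, $\varrho_n(x_0\otimes\cdots\otimes x_n)=(-1)^n(x_n\triangledown x_0)\otimes x_1\otimes\cdots\otimes x_{n-1}$. $b=\sum_{j=0}^n\mu_j\colon X_{vw}\to X_{v-1,w}$, $d'=\sum_{j=0}^{n-1}\varrho_j$ and $d=d'+\varrho_n\colon X_{vw}\to X_{v,w-1}$; $t(x_0\otimes\cdots\otimes x_n)=(-1)^{in}x_i\otimes\cdots\otimes x_n\otimes x_0\otimes\cdots\otimes x_{i-1}$, where $i$ is the last index with $x_i\in M$; $N=\sum_{l=0}^wt^l$ on $X_{vw}$. **Harmonic part.** $\ddot X_{vw}=X_{vw}\oplus X_{v,w-1}$, $\ddot b(\mathbf x,\mathbf y)=(b(\mathbf x),-b(\mathbf y))\in\ddot X_{v-1,w}$, $\ddot d(\mathbf x,\mathbf y)=(d(\mathbf x)+(\mathrm{id}-t)(\mathbf y),-d'(\mathbf y))\in\ddot X_{v,w-1}$, $\ddot B(\mathbf x,\mathbf y)=(0,N(\mathbf x))\in\ddot X_{v,w+1}$; Karoubi operator $\ddot\kappa(\mathbf x,\mathbf y)=(t(\mathbf x),t(\mathbf y)+d'(\mathbf x)-d(\mathbf x))$. One has $\ddot X=\ker(\ddot\kappa-\mathrm{id})^2\oplus\mathrm{Im}(\ddot\kappa-\mathrm{id})^2$; $P$ is the projection onto the first summand along the second. $P(\ddot X)=\ker(\ddot\kappa-\mathrm{id})^2$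 is stable under $\ddot b,\ddot d,\ddot B$. **Coinvariants.** $\overline X_{vw}$ is the cokernel of $\mathrm{id}-t\colon X_{vw}\to X_{vw}$; $[\mathbf x]$ is the class of $\mathbf x$; $\overline b,\overline d$ are induced by $b,d$; $\overline N\colon\overline X_{vw}\to X_{vw}$ is induced by $N$; $\mathfrak p\colon X_{vw}\to\overline X_{vw}$ is $\mathfrak p(\mathbf x)=\frac1{w+1}[\mathbf x]$; $\sigma'\colon X_{vw}\to X_{vw}$ is $\sigma'=\sum_{j=0}^{w-1}\frac{w-j}{w+1}t^j$. $\overline\xi\colon\overline X_{vw}\to\overline X_{v,w-2}$ is $\overline\xi(\mathbf x)=\frac1{w+1}\mathfrak p\circ d'\circ\sigma'\circ d\circ\overline N(\mathbf x)$ if $w>1$ and $0$ if $w\le1$. For a $t$-invariant $\mathbf x\in X_{vw}$, $\Upsilon(\mathbf x)=(-\mathrm{id}+\overline N\circ\mathfrak p)\circ\sigma'\circ d(\mathbf x)\in X_{v,w-1}$ if $w>0$, and $\Upsilon(\mathbf x)=0$ if $w=0$. $\widetilde X_{vw}=\overline X_{vw}\oplus\overline X_{v,w-1}$, $\widetilde{\mathfrak b}(\mathbf x,\mathbf y)=(\overline b(\mathbf x),-\overline b(\mathbf y))$, $\widetilde{\mathfrak d}(\mathbf x,\mathbf y)=(\overline d(\mathbf x),-\overline d(\mathbf y))$, $\widetilde\xi(\mathbf x,\mathbf y)=(0,\overline\xi(\mathbf x))\in\widetilde X_{v,w-1}$. A double mixed complex $(Y,b,\beta,B)$ is a bigraded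 $k$-module with $b$ of bidegree $(-1,0)$, $\beta$ of bidegree $(0,-1)$ and $B$ of bidegree $(0,1)$ satisfying $b^2=\beta^2=B^2=\beta b+b\beta=\beta B+B\beta=bB+Bb=0$; morphisms are bidegree-preserving maps commuting with the three maps. *)

(* Defs.v *)
From HB Require Import structures.
From mathcomp Require Import all_boot all_order all_algebra.
From mathcomp Require Import finmap boolp.
From mathcomp Require Import monalg.

Set Implicit Arguments.
Unset Strict Implicit.
Unset Printing Implicit Defensive.

Import GRing.Theory.
Local Open Scope ring_scope.
Local Open Scope quotient_scope.

Section QuotientModule.
Variables (k : pzRingType) (U : lmodType k).

Inductive span (R : U -> Prop) : U -> Prop :=
| span0 : span R 0
| span_cons c u v : R u -> span R v -> span R (c *: u + v).

Lemma span_lin (R : U -> Prop) c u v :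
  span R u -> span R v -> span R (c *: u + v).
Proof.
move=> su sv; elim: su => [|d u' v' Ru' _ IH]; first by rewrite scaler0 add0r.
by rewrite scalerDr scalerA -addrA; exact: span_cons.
Qed.

Definition spanb (R : U -> Prop) : {pred U} := fun u => `[< span R u >].

Lemma spanb_submod_closed R : submod_closed (spanb R).
Proof.
split=> [|c u v /asboolP su /asboolP sv]; apply/asboolP; first exact: span0.
exact: span_lin.
Qed.

HB.instance Definition _ R :=
  GRing.isSubmodClosed.Build k U (spanb R) (spanb_submod_closed R).

(* U modulo the submodule spanned by R *)
Definition quotm (R : U -> Prop) : Type := Quotient.quot (spanb R).

HB.instance Definition _ R := GRing.Zmodule.on (quotm R).
HB.instance Definition _ R := EqQuotient.on (quotm R).

Definition class_of (R : U -> Prop) (u : U) : quotm R := \pi_(quotm R) u.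

Section Scale.
Variable R : U -> Prop.

Definition qscale (c : k) (x : quotm R) : quotm R := class_of R (c *: repr x).

Lemma class_ofB : zmod_morphism (class_of R).
Proof. exact: (@raddfB _ _ \pi_(Quotient.quot (spanb R))). Qed.

Lemma class_of_eq u v : span R (u - v) -> class_of R u = class_of R v.
Proof. by move=> s; apply/eqP; rewrite -Quotient.idealrBE; apply/asboolP. Qed.

Lemma eq_class_of u v : class_of R u = class_of R v -> span R (u - v).
Proof. by move/eqP; rewrite -Quotient.idealrBE => /asboolP. Qed.

Lemma repr_class_of u : span R (repr (class_of R u) - u).
Proof. by apply: eq_class_of; rewrite /class_of reprK. Qed.

Lemma qscale_class c u : qscale c (class_of R u) = class_of R (c *: u).
Proof.
apply: class_of_eq; rewrite -scalerBr -[_ *: _]addr0.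
by apply: span_lin; [exact: repr_class_of | exact: span0].
Qed.

Lemma class_ofD u v : class_of R (u + v) = class_of R u + class_of R v.
Proof. exact: (@raddfD _ _ \pi_(Quotient.quot (spanb R))). Qed.

Lemma class_of_surj x : exists u, x = class_of R u.
Proof. by exists (repr x); rewrite /class_of reprK. Qed.

Lemma qscaleA a b x : qscale a (qscale b x) = qscale (a * b) x.
Proof. by have [u ->] := class_of_surj x; rewrite !qscale_class scalerA. Qed.

Lemma qscale1 : left_id 1 qscale.
Proof. by move=> x; have [u ->] := class_of_surj x; rewrite qscale_class scale1r. Qed.

Lemma qscaleDr : right_distributive qscale +%R.
Proof.
move=> a x y; have [u ->] := class_of_surj x; have [v ->] := class_of_surj y.
by rewrite -class_ofD !qscale_class -class_ofD scalerDr.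
Qed.

Lemma qscaleDl x : {morph qscale^~ x : a b / a + b}.
Proof.
by move=> a b; have [u ->] := class_of_surj x; rewrite !qscale_class -class_ofD scalerDl.
Qed.

HB.instance Definition _ :=
  GRing.Zmodule_isLmodule.Build k (quotm R) qscaleA qscale1 qscaleDr qscaleDl.

End Scale.
End QuotientModule.

Section Bimodules.
Variables (k : comNzRingType) (A : algType k).

Record bimodule := Bimodule {
  bimod :> lmodType k;
  lact : A -> bimod -> bimod;
  ract : bimod -> A -> bimod;
  _ : forall a, linear (lact a);
  _ : forall m, linear (fun a => lact a m);
  _ : forall a, linear (fun m => ract m a);
  _ : forall m, linear (ract m);
  _ : forall m, lact 1 m = m;
  _ : forall m, ract m 1 = m;
  _ : forall a a' m, lact (a * a') m = lact a (lact a' m);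
  _ : forall a a' m, ract m (a * a') = ract (ract m a) a';
  _ : forall a a' m, lact a (ract m a') = ract (lact a m) a' }.

(* A bimodule map M ⊗_A M -> M, given as an A-balanced bilinear map. *)
Record assoc_product (M : bimodule) (tri : M -> M -> M) : Prop := {
  tri_linearl : forall m', linear (fun m => tri m m');
  tri_linearr : forall m, linear (tri m);
  tri_balanced : forall m a m', tri (ract m a) m' = tri m (lact a m');
  tri_lact : forall a m m', tri (lact a m) m' = lact a (tri m m');
  tri_ract : forall a m m', tri m (ract m' a) = ract (tri m m') a;
  tri_assoc : associative tri }.

End Bimodules.

Section BigradedModules.
Variable k : pzRingType.

(* F_{w-1}, with F_{-1} = 0 *)
Definition shift (F : nat -> lmodType k) (w : nat) : lmodType k :=
  if w is w'.+1 then F w' else 'rV[k]_0.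

Definition shift_map (F G : nat -> lmodType k) (f : forall w, F w -> G w) w :
    shift F w -> shift G w :=
  match w return shift F w -> shift G w with
  | 0 => fun _ => 0
  | w'.+1 => f w'
  end.

(* Bigraded submodules [sub] of bigraded modules [car] vanishing outside
   v, w >= 0; the maps of bidegree (-1,0), (0,-1) and (0,1) are zero where they
   are not listed. Only the restrictions of the maps to [sub] are relevant. *)
Record dmc_data := DmcData {
  car : nat -> nat -> lmodType k;
  sub : forall v w, car v w -> Prop;
  dmc_b : forall v w, car v.+1 w -> car v w;
  dmc_beta : forall v w, car v w.+1 -> car v w;
  dmc_B : forall v w, car v w -> car v w.+1 }.

Definition submodule (U : lmodType k) (S : U -> Prop) : Prop :=
  S 0 /\ forall c x y, S x -> S y -> S (c *: x + y).

Definition linear_on (U V : lmodType k) (S : U -> Prop) (T : V -> Prop)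
    (f : U -> V) : Prop :=
  (forall x, S x -> T (f x)) /\
  (forall c x y, S x -> S y -> f (c *: x + y) = c *: f x + f y).

Arguments sub : clear implicits.

Record is_double_mixed_complex (Y : dmc_data) : Prop := {
  dmc_submodule : forall v w, submodule (sub Y v w);
  dmc_b_linear : forall v w, linear_on (sub Y v.+1 w) (sub Y v w) (@dmc_b Y v w);
  dmc_beta_linear :
    forall v w, linear_on (sub Y v w.+1) (sub Y v w) (@dmc_beta Y v w);
  dmc_B_linear : forall v w, linear_on (sub Y v w) (sub Y v w.+1) (@dmc_B Y v w);
  dmc_bb : forall v w x, sub Y v.+2 w x -> dmc_b (dmc_b x) = 0;
  dmc_betabeta : forall v w x, sub Y v w.+2 x -> dmc_beta (dmc_beta x) = 0;
  dmc_BB : forall v w x, sub Y v w x -> dmc_B (dmc_B x) = 0;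
  dmc_betab : forall v w x, sub Y v.+1 w.+1 x ->
    dmc_beta (dmc_b x) + dmc_b (dmc_beta x) = 0;
  dmc_betaB : forall v w x, sub Y v w.+1 x ->
    dmc_beta (dmc_B x) + dmc_B (dmc_beta x) = 0;
  dmc_betaB0 : forall v x, sub Y v 0 x -> dmc_beta (dmc_B x) = 0;
  dmc_bB : forall v w x, sub Y v.+1 w x ->
    dmc_b (dmc_B x) + dmc_B (dmc_b x) = 0 }.

Record is_dmc_morphism (Y Z : dmc_data) (f : forall v w, car Y v w -> car Z v w) :
    Prop := {
  dmc_mor_linear : forall v w, linear_on (sub Y v w) (sub Z v w) (f v w);
  dmc_mor_b : forall v w x, sub Y v.+1 w x -> f v w (dmc_b x) = dmc_b (f v.+1 w x);
  dmc_mor_beta : forall v w x, sub Y v w.+1 x ->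
    f v w (dmc_beta x) = dmc_beta (f v w.+1 x);
  dmc_mor_B : forall v w x, sub Y v w x -> f v w.+1 (dmc_B x) = dmc_B (f v w x) }.

Definition is_dmc_isomorphism (Y Z : dmc_data)
    (f : forall v w, car Y v w -> car Z v w) : Prop :=
  is_dmc_morphism f /\
  exists g : forall v w, car Z v w -> car Y v w,
    [/\ is_dmc_morphism g,
        forall v w x, sub Y v w x -> g v w (f v w x) = x
      & forall v w x, sub Z v w x -> f v w (g v w x) = x].

End BigradedModules.

(* The ring morphism iota : Q -> k expresses that Q is contained in k. *)
Section Complexes.
Variables (k : comNzRingType) (iota : {rmorphism rat -> k}).
Variables (A : algType k) (M : bimodule A) (tri : M -> M -> M) (K : {pred A}).

Definition letter : Type := (A + M)%type.
HB.instance Definition _ := Choice.on letter.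

Definition inA (x : letter) : bool := if x is inl _ then true else false.
Definition inM (x : letter) : bool := if x is inr _ then true else false.

(* The value 0 of the two products is taken to be the zero of M; a tensor with
   this factor is 0. *)
Definition letter0 : letter := inr 0.

Definition mulL (x y : letter) : letter :=
  match x, y with
  | inl a, inl a' => inl (a * a')
  | inl a, inr m => inr (lact a m)
  | inr m, inl a => inr (ract m a)
  | inr _, inr _ => letter0
  end.

Definition triL (x y : letter) : letter :=
  match x, y with
  | inr m, inr m' => inr (tri m m')
  | _, _ => letter0
  end.

(* The words x_0 ... x_n with x_0 in M and, in positions 1, ..., n, exactly v
   letters in A and w letters in M. *)
Definition is_word (v w : nat) (s : seq letter) : bool :=
  if s is x :: s' then [&& inM x, count inA s' == v & count inM s' == w]
  else false.

Definition word (v w : nat) : Type := {s : seq letter | is_word v w s}.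
HB.instance Definition _ v w := Choice.on (word v w).

Section Presentation.
Variables v w : nat.

Definition gen (s : seq letter) : {malg k[word v w]} :=
  if insub s is Some u then << (u : word v w) >> else 0.

(* Defining relations of M ⊗_K B^n_w ⊗ : k-multilinearity, vanishing of K in A/K,
   K-balancing of consecutive factors, and v λ = λ v for λ in K. *)
Inductive relator : {malg k[word v w]} -> Prop :=
| rel_linA s1 s2 c a a' :
    relator (gen (s1 ++ inl (c *: a + a') :: s2)
             - (c *: gen (s1 ++ inl a :: s2) + gen (s1 ++ inl a' :: s2)))
| rel_linM s1 s2 c m m' :
    relator (gen (s1 ++ inr (c *: m + m') :: s2)
             - (c *: gen (s1 ++ inr m :: s2) + gen (s1 ++ inr m' :: s2)))
| rel_K s1 s2 a : a \in K -> relator (gen (s1 ++ inl a :: s2))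
| rel_balanced s1 s2 x y a : a \in K ->
    relator (gen (s1 ++ mulL x (inl a) :: y :: s2)
             - gen (s1 ++ x :: mulL (inl a) y :: s2))
| rel_cyclic1 x a : a \in K ->
    relator (gen [:: mulL x (inl a)] - gen [:: mulL (inl a) x])
| rel_cyclic x s y a : a \in K ->
    relator (gen (x :: rcons s (mulL y (inl a)))
             - gen (mulL (inl a) x :: rcons s y)).

Definition X : lmodType k := quotm relator.

(* The class x_0 ⊗ ... ⊗ x_n *)
Definition tensor (s : seq letter) : X := class_of relator (gen s).

(* The map on X_{vw} given by f on simple tensors, computed on a representative;
   meaningful when the linear extension of f vanishes on the relators. *)
Definition on_tensors (Y : lmodType k) (f : seq letter -> Y) (x : X) : Y :=
  let g : {malg k[word v w]} := repr (x : quotm relator) in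
  \sum_(u <- msupp g) g@_u *: f (val u).

End Presentation.

(* x_0 ⊗ ... ⊗ op x_j x_{j+1} ⊗ ... ⊗ x_n for j < n = (size s).-1, and
   op x_n x_0 ⊗ x_1 ⊗ ... ⊗ x_{n-1} for j = n *)
Definition contract (op : letter -> letter -> letter) (j : nat)
    (s : seq letter) : seq letter :=
  if (j.+1 < size s)%N
  then take j s ++ op (nth letter0 s j) (nth letter0 s j.+1) :: drop j.+2 s
  else op (last letter0 s) (head letter0 s) :: behead (take (size s).-1 s).

Definition mu v w (j : nat) (s : seq letter) : X v w :=
  (-1) ^+ j *: tensor v w (contract mulL j s).

Definition rho v w (j : nat) (s : seq letter) : X v w :=
  (-1) ^+ j *: tensor v w (contract triL j s).

Definition bX v w : X v.+1 w -> X v w :=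
  on_tensors (fun s => \sum_(j < size s) mu v w j s).

Definition dX' v w : X v w -> shift (X v) w :=
  match w return X v w -> shift (X v) w with
  | 0 => fun _ => 0
  | w'.+1 => on_tensors (fun s => \sum_(j < (size s).-1) rho v w' j s)
  end.

Definition dX v w : X v w -> shift (X v) w :=
  match w return X v w -> shift (X v) w with
  | 0 => fun _ => 0
  | w'.+1 => on_tensors (fun s => \sum_(j < size s) rho v w' j s)
  end.

Definition last_inM (s : seq letter) : nat :=
  (\max_(i < size s | inM (nth letter0 s i)) i)%N.

Definition tX v w : X v w -> X v w :=
  on_tensors (fun s =>
    (-1) ^+ (last_inM s * (size s).-1) *: tensor v w (rot (last_inM s) s)).

Definition NX v w (x : X v w) : X v w := \sum_(l < w.+1) iter l (@tX v w) x.

Definition Xdd v w : lmodType k := (X v w * shift (X v) w)%type.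

Definition bdd v w (z : Xdd v.+1 w) : Xdd v w :=
  (bX z.1, - shift_map (@bX v) z.2).

Definition ddd v w (z : Xdd v w.+1) : Xdd v w :=
  (dX z.1 + (z.2 - tX z.2), - dX' (z.2 : X v w)).

Definition Bdd v w (z : Xdd v w) : Xdd v w.+1 := (0, NX z.1).

Definition kappa v w (z : Xdd v w) : Xdd v w :=
  (tX z.1, shift_map (@tX v) z.2 + dX' z.1 - dX z.1).

(* P(Xdd) = ker (kappa - id)^2 *)
Definition harmonic v w (z : Xdd v w) : Prop :=
  let km1 (u : Xdd v w) := kappa u - u in km1 (km1 z) = 0.

Definition PXdd : dmc_data k := DmcData harmonic bdd ddd Bdd.

Definition coinv_rel v w (u : X v w) : Prop := exists x, u = x - tX x.

Definition Xbar v w : lmodType k := quotm (@coinv_rel v w).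

Definition clX v w (x : X v w) : Xbar v w := class_of (@coinv_rel v w) x.

(* A representative in X_{vw}; bbar, dbar and Nbar do not depend on its choice. *)
Definition lifted v w (x : Xbar v w) : X v w := repr (x : quotm (@coinv_rel v w)).

Definition bbar v w (x : Xbar v.+1 w) : Xbar v w := clX (bX (lifted x)).

Definition dbar v w (x : Xbar v w) : shift (Xbar v) w :=
  shift_map (@clX v) (dX (lifted x)).

Definition Nbar v w (x : Xbar v w) : X v w := NX (lifted x).

Definition frak_p v w (x : X v w) : Xbar v w :=
  iota (1 / w.+1%:R) *: clX x.

Definition sigma' v w (x : X v w) : X v w :=
  \sum_(j < w) iota ((w - j)%:R / w.+1%:R) *: iter j (@tX v w) x.

(* The map from Xbar_{v,w+1} to Xbar_{v,w-1}. *)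
Definition xibar v w : Xbar v w.+1 -> shift (Xbar v) w :=
  match w return Xbar v w.+1 -> shift (Xbar v) w with
  | 0 => fun _ => 0
  | w'.+1 => fun x =>
      iota (1 / w'.+3%:R) *:
        frak_p (dX' (sigma' (dX (Nbar x) : X v w'.+1)) : X v w')
  end.

Definition Upsilon v w : X v w -> shift (X v) w :=
  match w return X v w -> shift (X v) w with
  | 0 => fun _ => 0
  | w'.+1 => fun x =>
      let y : X v w' := sigma' (dX x : X v w') in - y + Nbar (frak_p y)
  end.

Definition Xt v w : lmodType k := (Xbar v w * shift (Xbar v) w)%type.

Definition bt v w (z : Xt v.+1 w) : Xt v w :=
  (bbar z.1, - shift_map (@bbar v) z.2).

Definition dt v w (z : Xt v w.+1) : Xt v w :=
  (dbar z.1, - dbar (z.2 : Xbar v w)).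

Definition xit v w (z : Xt v w.+1) : Xt v w := (0, xibar z.1).

Definition Bt v w (z : Xt v w) : Xt v w.+1 := (0, z.1).

Definition Xtilde : dmc_data k :=
  @DmcData k Xt (fun _ _ _ => True) bt (fun v w z => dt z + xit z) Bt.

Definition Psi v w (z : Xt v w) : Xdd v w :=
  iota (1 / w.+1%:R) *: ((Nbar z.1, Upsilon (Nbar z.1)) : Xdd v w)
  + ((0, shift_map (@Nbar v) z.2) : Xdd v w).

End Complexes.

Arguments Psi {k} iota {A M} tri K {v w}.

(* Main.v *)
From HB Require Import structures.
Require Import Defs.
From mathcomp Require Import all_boot all_order all_algebra.
From mathcomp Require Import finmap.
From mathcomp Require Import monalg zify.

Set Implicit Arguments.
Unset Strict Implicit.
Unset Printing Implicit Defensive.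

Import GRing.Theory.
Local Open Scope ring_scope.

(** The idea of the proof. The operator t on X_{vw} has finite order w + 1, and w + 1 is
    invertible in k; hence X_{vw} is the direct sum of the t-invariants, onto which
    pi = N / (w + 1) projects, and of the image of id - t, and the norm identifies the
    coinvariants with the invariants (its inverse is the map p of the statement). The
    operator s = sigma' inverts id - t off the invariants: s - t s = id - pi.

    Because t is semisimple, a pair (u, y) is killed by (kappa - id)^2 if and only if u is
    invariant and (t - id) y is the part of d u in the image of id - t, that is, if and
    only if y - Upsilon(u) is invariant ([harmonic_succ]). So a harmonic pair amounts to
    two invariants, u and y - Upsilon(u), and Psi is bijective onto the harmonic part
    with inverse (u, y) |-> ((w + 1) p(u), p(y)), since p Upsilon = 0 ([psiK],
    [harmonicP]). That Psi commutes with b and B is immediate. For d, the first component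
    says that d maps u to the invariant pi d u up to (id - t) Upsilon(u), and the second
    one is the identity
      - d' Upsilon(u) = Upsilon(pi d u) + pi d' s d u,
    in which the last term is the contribution of xi ([upsilon1_key]). It holds because
    d' s d u + s d pi d u is invariant, which follows from d (id - t) = (id - t) d' and
    d d = 0. Finally both sides are double mixed complexes: the relations hold on the
    whole of the pairs, harmonic or not, the harmonic pairs are stable as the image of
    Psi, and the relations on the coinvariants are transported along Psi.

    What this uses about tensors is: b b = d d = d' d' = 0, b d + d b = b d' + d' b = 0,
    b t = t b, t^(w + 1) = id, d (id - t) = (id - t) d' and d' N = N d. The first ones are
    presimplicial: two contractions of a word commute or bracket three consecutive
    letters in two ways ([contract_contract]). For t, a word is cut into blocks, each a
    letter of M followed by letters of A; t moves the last block to the front with the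
    Koszul sign ([tX_block]), so that its powers move whole segments ([iter_tX]). With e
    the contraction of the first two letters by the product of M, this yields d = d' + e t
    and d t = t d' + e t ([dX_eq], [dX_tX]). A contraction at any other place becomes, under
    N, the contraction e of a rotated word, whence N d = N e N ([NX_dX_e0X]); these three
    relations imply d' N = N d ([norm_commutation]). *)

(** * Sums and linear maps *)

Lemma signr_odd_eq (R : pzRingType) a b : odd a = odd b -> (-1) ^+ a = (-1) ^+ b :> R.
Proof. by move=> e; rewrite -signr_odd e signr_odd. Qed.

Lemma signr_scale (R : pzRingType) (V : lmodType R) a b (x : V) :
  odd a = odd b -> (-1) ^+ a *: x = (-1) ^+ b *: x.
Proof. by move=> /signr_odd_eq ->. Qed.

Lemma addr_pairs (V : zmodType) (a b c d : V) : a + b + c + d = c + d + a + b.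
Proof. by rewrite -addrA addrC addrA. Qed.

Lemma addr_regroup (V : zmodType) (x y z u : V) : x + y - z - u = (x - u) + (y - z).
Proof. by rewrite -addrA -opprD (addrC z) opprD addrACA. Qed.

Lemma addr_cancel (V : zmodType) (x y z u : V) : x - (y + z) + y = u -> x - u = z.
Proof.
by rewrite (addrC y) opprD addrA subrK => <-; rewrite opprB addrCA subrr addr0.
Qed.

Lemma addr_telescope (V : zmodType) (x y z : V) : (x - y) + (z - x) = z - y.
Proof. by rewrite addrC addrA subrK. Qed.

Lemma addr_cancel4 (V : zmodType) (x y : V) : x - y + (- x + y) = 0.
Proof. by rewrite addrACA subrr addNr addr0. Qed.

Lemma addr_common (V : zmodType) (x y z u e : V) : x = z + e -> y = u + e -> x - y = z - u.
Proof. by move=> -> ->; rewrite opprD addrACA subrr addr0. Qed.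

Lemma addr_split0 (V : zmodType) (x y z u : V) : x + y + (z + u) = 0 -> y + u = 0 -> x + z = 0.
Proof. by rewrite addrACA => + e; rewrite e addr0. Qed.

Section LinearMaps.
Variable k : comNzRingType.

Fact linear_zero (U V : lmodType k) (f : U -> V) : linear f -> f 0 = 0.
Proof. by move=> lf; have := lf (-1) 0 0; rewrite scaler0 addr0 scaleN1r addNr. Qed.

Lemma linear_scale (U V : lmodType k) (f : U -> V) c x : linear f -> f (c *: x) = c *: f x.
Proof. by move=> lf; have := lf c x 0; rewrite !addr0 (linear_zero lf) addr0. Qed.

Lemma linear_addE (U V : lmodType k) (f : U -> V) x y : linear f -> f (x + y) = f x + f y.
Proof. by move=> lf; have := lf 1 x y; rewrite !scale1r. Qed.

Lemma linear_subE (U V : lmodType k) (f : U -> V) x y : linear f -> f (x - y) = f x - f y.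
Proof.
by move=> lf; rewrite (linear_addE _ _ lf) -scaleN1r (linear_scale _ _ lf) scaleN1r.
Qed.

Lemma linear_comp (U V W : lmodType k) (f : V -> W) (g : U -> V) :
  linear f -> linear g -> linear (fun x => f (g x)).
Proof. by move=> lf lg c x y; rewrite lg lf. Qed.

Lemma linear_add (U V : lmodType k) (f g : U -> V) :
  linear f -> linear g -> linear (fun x => f x + g x).
Proof. by move=> lf lg c x y; rewrite lf lg scalerDr addrACA. Qed.

Lemma linear_zero_fun (U V : lmodType k) : linear (fun _ : U => 0 : V).
Proof. by move=> c x y; rewrite scaler0 addr0. Qed.

Lemma linear_id (U : lmodType k) : linear (fun x : U => x).
Proof. by []. Qed.

Lemma shift0 (F : nat -> lmodType k) (x y : shift F 0) : x = y.
Proof. by rewrite [x](thinmx0 x) [y](thinmx0 y). Qed.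

Fact shift_map_linear (F G : nat -> lmodType k) (f : forall w, F w -> G w) w :
  (forall w, linear (f w)) -> linear (@shift_map k F G f w).
Proof. by case: w => [|w] lf c x y; [exact: shift0 | exact: lf]. Qed.

End LinearMaps.

(** A linear function as a linear map. *)
Definition linear_bundle (k : pzRingType) (U V : lmodType k) (f : U -> V) (lf : linear f) :
  {linear U -> V} := HB.pack f (GRing.isLinear.Build k U V *:%R f lf).

Section SignedSums.
Variables (k : comNzRingType) (Y : lmodType k).

Lemma sum_two_cancel n p (f : nat -> Y) : (p.+1 < n)%N ->
  (forall j, (j < n)%N -> j != p -> j != p.+1 -> f j = 0) ->
  f p + f p.+1 = 0 -> \sum_(j < n) f j = 0.
Proof.
move=> pn f0 fp; have pn' := ltnW pn.
rewrite (bigD1 (Ordinal pn')) //= (bigD1 (Ordinal pn)) /=; last first.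
  by rewrite -val_eqE /= gtn_eqF.
rewrite addrA fp add0r big1 // => j /andP[]; rewrite -!val_eqE /= => jp jp'.
exact: f0.
Qed.

(** The combinatorial core of a presimplicial identity: the terms (i, j) with i < j
    cancel against the terms (j - 1, i). *)
Lemma presimplicial_sum m (f : nat -> nat -> Y) :
  (forall i j, (i < j)%N -> (j <= m)%N -> f i j = f j.-1 i) ->
  \sum_(j < m.+1) (-1) ^+ j *: \sum_(i < m) (-1) ^+ i *: f i j = 0.
Proof.
elim: m => [|m IH] hf.
  by rewrite big_ord_recl !big_ord0 scaler0 addr0.
rewrite big_ord_recr /=.
under eq_bigr do rewrite big_ord_recr /= scalerDr.
rewrite big_split /= IH; last by move=> i j ij jm; apply: hf => //; exact: leqW.
rewrite add0r scaler_sumr -big_split big1 //= => i _.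
by rewrite (hf i m.+1) // !scalerA -!exprD addSn exprS mulN1r scaleNr addnC subrr.
Qed.

(** The same cancellation between two simple sums, g having one more term at 0. *)
Lemma shifted_sum n (f g : nat -> Y) : f 0%N + g 0%N = g 1%N ->
  (forall i, (0 < i <= n)%N -> f i = g i.+1) ->
  \sum_(i < n.+1) (-1) ^+ i *: f i + \sum_(j < n.+2) (-1) ^+ j *: g j = 0.
Proof.
move=> h0 hi; rewrite big_ord_recl [X in _ + X]big_ord_recl addrACA !scale1r /= h0.
rewrite [X in _ + (_ + X)]big_ord_recl /= scaleN1r.
rewrite (addrCA (\sum_(i < n) _)) addrA subrr add0r -big_split big1 //= => i _.
by rewrite hi ?ltn_ord // [X in _ + X *: _]exprS mulN1r scaleNr subrr.
Qed.

Lemma linear_lcomb_sum (Z : lmodType k) (f : Y -> Z) n (c : 'I_n -> k) (x : 'I_n -> Y) :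
  linear f -> f (\sum_(j < n) c j *: x j) = \sum_(j < n) c j *: f (x j).
Proof.
move=> lf; rewrite -[f]/(linear_bundle lf : Y -> Z) linear_sum.
by apply: eq_bigr => j _; rewrite linearZ.
Qed.

Lemma linear_big (Z : lmodType k) (f : Y -> Z) n (x : 'I_n -> Y) :
  linear f -> f (\sum_(j < n) x j) = \sum_(j < n) f (x j).
Proof.
move=> lf; have := linear_lcomb_sum (fun=> 1) x lf.
under eq_bigr do rewrite scale1r.
by under [in RHS]eq_bigr do rewrite scale1r.
Qed.

End SignedSums.

Section Quotients.
Variables (k : pzRingType) (U : lmodType k) (R : U -> Prop).

Lemma class_of0 : class_of R 0 = 0.
Proof. by apply: (addrI (class_of R 0)); rewrite -class_ofD !addr0. Qed.

Lemma class_of_rel u : R u -> class_of R u = 0.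
Proof.
move=> Ru; rewrite -class_of0; apply: class_of_eq; rewrite subr0 -[u]scale1r -[_ *: _]addr0.
by apply: Defs.span_cons => //; exact: Defs.span0.
Qed.

Lemma class_ofZ c u : class_of R (c *: u) = c *: class_of R u.
Proof. by rewrite [RHS]qscale_class. Qed.

End Quotients.

(** * Operators of finite order *)

Section CyclicModule.
Variables (k : comNzRingType) (iota : {rmorphism rat -> k}).

(** The inverse of n + 1. *)
Definition qinv (n : nat) : k := iota (1 / n.+1%:R).

Lemma qinvK n : qinv n * n.+1%:R = 1.
Proof.
by rewrite /qinv -(rmorph_nat iota n.+1) -rmorphM /= divfK ?Num.Theory.pnatr_eq0 // rmorph1.
Qed.

Lemma qinvE (m n : nat) : iota (m%:R / n.+1%:R) = qinv n * m%:R.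
Proof. by rewrite /qinv -(rmorph_nat iota m) -rmorphM /= div1r mulrC. Qed.

Lemma qinvVK n (V : lmodType k) (x : V) : qinv n *: (n.+1%:R *: x) = x.
Proof. by rewrite scalerA qinvK scale1r. Qed.

Lemma qinvKV n (V : lmodType k) (x : V) : n.+1%:R *: (qinv n *: x) = x.
Proof. by rewrite scalerA mulrC qinvK scale1r. Qed.

Variables (V : lmodType k) (t : {linear V -> V}) (w : nat).
Hypothesis t_order : forall x, iter w.+1 t x = x.

(** The norm, that is, the sum of the powers of t. *)
Definition norm (x : V) : V := \sum_(l < w.+1) iter l t x.

(** The projection pi onto the t-invariants. *)
Definition invp (x : V) : V := qinv w *: norm x.

(** An inverse of id - t off the invariants, see [sig_sub_t]. *)
Definition sig (x : V) : V := \sum_(j < w) iota ((w - j)%:R / w.+1%:R) *: iter j t x.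

Fact iter_linear j : linear (iter j t).
Proof. by elim: j => [|j IH] c x y //=; rewrite IH linearP. Qed.

Fact norm_linear : linear norm.
Proof.
move=> c x y; rewrite /norm scaler_sumr -big_split; apply: eq_bigr => l _.
exact: iter_linear.
Qed.
HB.instance Definition _ := GRing.isLinear.Build k V V *:%R norm norm_linear.

Fact invp_linear : linear invp.
Proof. by move=> c x y; rewrite /invp linearP scalerDr !scalerA mulrC. Qed.
HB.instance Definition _ := GRing.isLinear.Build k V V *:%R invp invp_linear.

Fact sig_linear : linear sig.
Proof.
move=> c x y; rewrite /sig scaler_sumr -big_split; apply: eq_bigr => l _.
by rewrite /= iter_linear scalerDr !scalerA mulrC.
Qed.
HB.instance Definition _ := GRing.isLinear.Build k V V *:%R sig sig_linear.

Lemma norm_t x : norm (t x) = norm x.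
Proof.
rewrite /norm big_ord_recr [RHS]big_ord_recl /= -iterSr t_order addrC; congr (_ + _).
by apply: eq_bigr => l _; rewrite -iterSr.
Qed.

Lemma t_norm x : t (norm x) = norm x.
Proof.
by rewrite -[RHS]norm_t /norm linear_sum; apply: eq_bigr => l _; rewrite -iterSr.
Qed.

Lemma t_invp x : t (invp x) = invp x.
Proof. by rewrite /invp linearZ t_norm. Qed.

Lemma invp_t x : invp (t x) = invp x.
Proof. by rewrite /invp norm_t. Qed.

Lemma norm_invariant x : t x = x -> norm x = w.+1%:R *: x.
Proof.
move=> tx; have h n : iter n t x = x by elim: n => //= n ->.
by rewrite /norm (eq_bigr (fun=> x)) // sumr_const card_ord scaler_nat.
Qed.

Lemma invp_invariant x : t x = x -> invp x = x.
Proof. by move=> tx; rewrite /invp norm_invariant // qinvVK. Qed.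

Lemma invp_sub_t x : t x = x -> forall y, x = t y - y -> x = 0.
Proof.
by move=> tx y e; rewrite -(invp_invariant tx) e linearB /= invp_t subrr.
Qed.

(** An operator of finite order is semisimple at the eigenvalue 1. *)
Lemma invariant_of_sq x : t (t x - x) - (t x - x) = 0 -> t x = x.
Proof. by move=> /subr0_eq h; apply/subr0_eq; exact: (invp_sub_t h (y := x)). Qed.

Lemma sig_sub_t x : sig x - t (sig x) = x - invp x.
Proof.
pose G := \sum_(j < w.+1) (w - j)%:R *: iter j t x.
have eG : sig x = qinv w *: G.
  rewrite /G big_ord_recr /= subnn scale0r addr0 scaler_sumr.
  by apply: eq_bigr => j _; rewrite qinvE scalerA.
have G0 : G = w%:R *: x + \sum_(j < w) (w - j.+1)%:R *: iter j.+1 t x.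
  by rewrite /G big_ord_recl subn0.
have G1 : t G = \sum_(j < w) (w - j)%:R *: iter j.+1 t x.
  rewrite /G big_ord_recr /= subnn scale0r addr0 linear_sum.
  by apply: eq_bigr => j _; rewrite linearZ.
have GG : G - t G = w.+1%:R *: x - norm x.
  rewrite G1 G0 /norm big_ord_recl /= opprD -natr1 scalerDl scale1r addrA addrK -addrA.
  rewrite -sumrB -sumrN; congr (_ + _); apply: eq_bigr => j _ /=.
  rewrite -scalerBl; have -> : (w - j = (w - j.+1).+1)%N by rewrite subnSK.
  by rewrite -natr1 opprD addNKr scaleN1r.
by rewrite eG linearZ -scalerBr GG scalerBr qinvVK.
Qed.

Lemma invp_sig x : exists c, invp (sig x) = c *: invp x.
Proof.
exists (\sum_(j < w) iota ((w - j)%:R / w.+1%:R)).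
rewrite /sig linear_sum scaler_suml; apply: eq_bigr => j _; rewrite linearZ /=; congr (_ *: _).
by elim: (nat_of_ord j) => //= i IH; rewrite invp_t.
Qed.

End CyclicModule.

(** If d = d' + e s and d s = t d' + e s, and if N d = N e N, then d' N = N d: the value
    of d' on an invariant y is invariant, so that a multiple of it is its norm. *)
Lemma norm_commutation (k : comNzRingType) (iota : {rmorphism rat -> k})
    (V W : lmodType k) (w : nat) (s : {linear V -> V}) (t : {linear W -> W})
    (d d' e : V -> W) : linear e ->
  (forall x, iter w.+2 s x = x) -> (forall x, iter w.+1 t x = x) ->
  (forall x, d x = d' x + e (s x)) -> (forall x, d (s x) = t (d' x) + e (s x)) ->
  (forall x, norm t w (d x) = norm t w (e (norm s w.+1 x))) ->
  forall x, d' (norm s w.+1 x) = norm t w (d x).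
Proof.
move=> el s_order t_order d_e d_s N_d x; set y := norm s w.+1 x.
have sy : s y = y by exact: t_norm.
have d_y : d y = d' y + e y by rewrite d_e sy.
have td' : t (d' y) = d' y.
  by apply: (addIr (e y)); rewrite -d_y -{2}sy -d_s sy.
have e1 : norm t w (d' y) = w.+1%:R *: d' y by exact: norm_invariant.
have e2 : norm t w (d y) = w.+2%:R *: norm t w (d x).
  rewrite (N_d x) -/y (N_d y) (norm_invariant w.+1 sy).
  by rewrite (linear_scale _ _ el) (linear_scale _ _ (norm_linear t w)).
have e3 : norm t w (d y) = norm t w (d' y) + norm t w (d x).
  by rewrite d_y linearD /= (N_d x).
rewrite -[LHS](qinvVK iota w) -e1 -[RHS](qinvVK iota w); congr (_ *: _).
by apply: (addIr (norm t w (d x))); rewrite -e3 e2 -[w.+2%:R]natr1 scalerDl scale1r.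
Qed.

(** * Maps out of a free module *)

Section FreeModule.
Variables (k : comNzRingType) (T : choiceType) (Y : lmodType k) (F : T -> Y).

(** The linear extension of a function on the basis T of the free module. *)
Definition free_ext (g : {malg k[T]}) : Y := \sum_(u <- msupp g) g@_u *: F u.

Lemma free_extEw (d : {fset T}) (g : {malg k[T]}) : (msupp g `<=` d)%fset ->
  free_ext g = \sum_(u <- d) g@_u *: F u.
Proof.
move=> le; rewrite /free_ext (big_fset_incl _ le) // => x xd /mcoeff_outdom ->.
by rewrite scale0r.
Qed.

Lemma free_ext_linear : linear free_ext.
Proof.
move=> c g h; pose d := (msupp g `|` msupp h `|` msupp (c *: g + h))%fset.
have sg : (msupp g `<=` d)%fset by rewrite /d -fsetUA fsubsetUl.
have sh : (msupp h `<=` d)%fset.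
  by rewrite /d; apply: fsubset_trans (fsubsetUl _ _); exact: fsubsetUr.
have sc : (msupp (c *: g + h) `<=` d)%fset by exact: fsubsetUr.
rewrite (free_extEw sg) (free_extEw sh) (free_extEw sc) scaler_sumr -big_split /=.
by apply: eq_bigr => u _; rewrite mcoeffD mcoeffZ scalerDl scalerA.
Qed.

HB.instance Definition _ :=
  GRing.isLinear.Build k {malg k[T]} Y *:%R free_ext free_ext_linear.

Lemma free_extU u : free_ext << u >> = F u.
Proof. by rewrite (free_extEw (msuppU_le (k:=u))) big_seq_fset1 mcoeffUU scale1r. Qed.

Lemma malgU_scale (c : k) (u : T) : << c *g u >> = c *: << u >> :> {malg k[T]}.
Proof. by apply/malgP => u'; rewrite mcoeffZ !mcoeffU mulr_natr. Qed.

Lemma class_of_malgU (R : {malg k[T]} -> Prop) (c : k) (u : T) :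
  class_of R << c *g u >> = c *: class_of R << u >>.
Proof. rewrite malgU_scale; exact: class_ofZ. Qed.

End FreeModule.

Section Tensors.
Variables (k : comNzRingType) (A : algType k) (M : bimodule A).
Variables (tri : M -> M -> M) (K : {pred A}).
Hypothesis htri : assoc_product tri.

Notation L := (letter M).

(** * Bimodule actions and contractions of letters *)

Fact lact_linear a : linear (@lact _ _ M a). Proof. by case: M a. Qed.
Fact lact_linearl m : linear (fun a => @lact _ _ M a m). Proof. by case: M m. Qed.
Fact ract_linear a : linear (fun m => @ract _ _ M m a). Proof. by case: M a. Qed.
Fact ract_linearr m : linear (@ract _ _ M m). Proof. by case: M m. Qed.
Fact lactM a b m : @lact _ _ M (a * b) m = lact a (lact b m). Proof. by case: M m. Qed.
Fact ractM a b m : @ract _ _ M m (a * b) = ract (ract m a) b. Proof. by case: M m. Qed.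
Fact lact_ract a b m : @lact _ _ M a (ract m b) = ract (lact a m) b.
Proof. by case: M m. Qed.

Fact lact0 a : @lact _ _ M a 0 = 0. Proof. exact: linear_zero (lact_linear a). Qed.
Fact ract0 a : @ract _ _ M 0 a = 0. Proof. exact: linear_zero (ract_linear a). Qed.
Fact tri0m m : tri 0 m = 0. Proof. exact: linear_zero (tri_linearl htri m). Qed.
Fact trim0 m : tri m 0 = 0. Proof. exact: linear_zero (tri_linearr htri m). Qed.

(** [lcomb c x y z]: x, y and z are letters of the same type, with z = c x + y. *)
Variant lcomb (c : k) : L -> L -> L -> Prop :=
| LcombA a a' : lcomb c (inl a) (inl a') (inl (c *: a + a'))
| LcombM m m' : lcomb c (inr m) (inr m') (inr (c *: m + m')).

(** The properties common to the two products of letters that make contractions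
    compatible with the relations between tensors. *)
Record contraction_op (op : L -> L -> L) : Prop := {
  cop_linl : forall c x y z u, lcomb c x y z -> lcomb c (op x u) (op y u) (op z u);
  cop_linr : forall c x y z u, lcomb c x y z -> lcomb c (op u x) (op u y) (op u z);
  cop_bal : forall a x y, op (mulL x (inl a)) y = op x (mulL (inl a) y);
  cop_mull : forall a x y, mulL (inl a) (op x y) = op (mulL (inl a) x) y;
  cop_mulr : forall a x y, op x (mulL y (inl a)) = mulL (op x y) (inl a);
  cop_0l : forall x, op (letter0 M) x = letter0 M;
  cop_0r : forall x, op x (letter0 M) = letter0 M;
  cop_inMl : forall x y, inM x -> inM (op x y);
  cop_inMr : forall x y, inM y -> inM (op x y) }.

Fact lcomb0 c : lcomb c (letter0 M) (letter0 M) (letter0 M).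
Proof. by have := LcombM c 0 0; rewrite scaler0 addr0. Qed.

Lemma mulLA : associative (@mulL _ _ M).
Proof.
move=> [a|m] [b|n] [c|p] //=;
  by rewrite ?mulrA ?lactM ?ractM ?lact_ract ?lact0 ?ract0.
Qed.

Lemma triLA : associative (triL tri).
Proof. by move=> [a|m] [b|n] [c|p] //=; rewrite ?(tri_assoc htri) ?tri0m ?trim0. Qed.

Lemma mulL_contraction : contraction_op (@mulL _ _ M).
Proof.
split=> [c x y z u|c x y z u|a x y|a x y|a x y|x|x|x y|x y]; try by rewrite mulLA.
- case=> [a a'|m m']; case: u => [b|n] /=; last exact: lcomb0.
  + rewrite mulrDl -scalerAl; exact: LcombA.
  + rewrite lact_linearl; exact: LcombM.
  + rewrite ract_linear; exact: LcombM.
- case=> [a a'|m m']; case: u => [b|n] /=; last exact: lcomb0.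
  + rewrite mulrDr -scalerAr; exact: LcombA.
  + rewrite ract_linearr; exact: LcombM.
  + rewrite lact_linear; exact: LcombM.
- by case: x => [a|m] //=; rewrite ract0.
- by case: x => [a|m] //=; rewrite lact0.
- by case: x y => [a|m] [b|n].
- by case: x y => [a|m] [b|n].
Qed.

Lemma triL_contraction : contraction_op (triL tri).
Proof.
split=> [c x y z u|c x y z u|a x y|a x y|a x y|x|x|x y|x y].
- case=> [a a'|m m']; case: u => [b|n] /=; try exact: lcomb0.
  rewrite (tri_linearl htri); exact: LcombM.
- case=> [a a'|m m']; case: u => [b|n] /=; try exact: lcomb0.
  rewrite (tri_linearr htri); exact: LcombM.
- by case: x y => [b|m] [c|n] //=; rewrite ?(tri_balanced htri).
- by case: x y => [b|m] [c|n] //=; rewrite ?lact0 ?(tri_lact htri).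
- by case: x y => [b|m] [c|n] //=; rewrite ?ract0 ?(tri_ract htri).
- by case: x => [a|m] //=; rewrite tri0m.
- by case: x => [a|m] //=; rewrite trim0.
- by case: x y => [a|m] [b|n].
- by case: x y => [a|m] [b|n].
Qed.

(** * Contractions of words *)

Lemma contract_mid op s1 x y s2 :
  contract op (size s1) (s1 ++ x :: y :: s2) = s1 ++ op x y :: s2 :> seq L.
Proof.
rewrite /contract size_cat /= -addn2 leq_add2l /= take_size_cat //.
rewrite !nth_cat ltnn subnn ltnNge leqnSn subSnn /=.
by rewrite -[x :: y :: s2]/([:: x; y] ++ s2) catA drop_size_cat // size_cat addn2.
Qed.

Lemma contract_end op x s y :
  contract op (size s).+1 (x :: rcons s y) = op y x :: s :> seq L.
Proof.
rewrite /contract /= size_rcons ltnn last_rcons /= -cats1 take_size_cat //.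
Qed.

Lemma contract0 op x y s : contract op 0 (x :: y :: s) = op x y :: s :> seq L.
Proof. exact: (contract_mid op [::]). Qed.

Lemma split_at2 j (s : seq L) : (j.+1 < size s)%N ->
  exists s1 x y s2, s = s1 ++ x :: y :: s2 /\ j = size s1.
Proof.
move=> js; exists (take j s), (nth (letter0 M) s j), (nth (letter0 M) s j.+1), (drop j.+2 s).
by rewrite -(drop_nth _ js) -(drop_nth _ (ltnW js)) cat_take_drop size_takel ?(ltnW (ltnW js)).
Qed.

Lemma split_ends (s : seq L) : (1 < size s)%N -> exists x r y, s = x :: rcons r y.
Proof. by case: s => [|x s] //; case/lastP: s => // r y _; exists x, r, y. Qed.

Lemma contract_rot op j (s : seq L) : (j.+1 < size s)%N ->
  contract op j s = rotr j (contract op 0 (rot j s)).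
Proof.
case/split_at2 => s1 [x [y [s2 [-> ->]]]].
by rewrite contract_mid rot_size_cat /= contract0 -cat_cons rotr_size_cat.
Qed.

Lemma contract_rot_end op j (s : seq L) : (1 < size s)%N -> j.+1 = size s ->
  contract op j s = contract op 0 (rot j s).
Proof.
case/split_ends => x [r [y ->]]; rewrite /= size_rcons => -[->]; rewrite contract_end.
by rewrite -rcons_cons -cats1 (rot_size_cat (x :: r)) /= contract0.
Qed.

Lemma size_contract op j (s : seq L) : (1 < size s)%N -> (j < size s)%N ->
  size (contract op j s) = (size s).-1.
Proof.
move=> s1 js; have [js'|] := boolP (j.+1 < size s)%N.
  case/split_at2: js' => u [x [y [r [-> ->]]]].
  by rewrite contract_mid !size_cat /= !addnS.
rewrite -leqNgt => sj; have ej : j.+1 = size s by apply/eqP; rewrite eqn_leq js sj.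
case/split_ends: s1 ej => x [r [y ->]]; rewrite /= size_rcons => -[->].
by rewrite contract_end.
Qed.

(** * The defining relations, up to rotation *)

(** Words that agree but in one place, where the letters satisfy z = c x + y. This notion
    and the two following ones encode the relations between tensors; they are invariant
    under rotation of the words. *)
Variant word_lcomb (c : k) : seq L -> seq L -> seq L -> Prop :=
  WordLcomb s1 s2 x y z of lcomb c x y z :
    word_lcomb c (s1 ++ x :: s2) (s1 ++ y :: s2) (s1 ++ z :: s2).

(** A word with a letter in K. *)
Variant word_inK : seq L -> Prop :=
  WordInK s1 s2 a of a \in K : word_inK (s1 ++ inl a :: s2).

(** K-balancing, between consecutive letters or between the last letter and the first. *)
Variant word_bal : seq L -> seq L -> Prop :=
| WordBal s1 s2 x y a of a \in K :
    word_bal (s1 ++ mulL x (inl a) :: y :: s2) (s1 ++ x :: mulL (inl a) y :: s2)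
| WordBalEnd x s y a of a \in K :
    word_bal (x :: rcons s (mulL y (inl a))) (mulL (inl a) x :: rcons s y)
| WordBal1 x a of a \in K : word_bal [:: mulL x (inl a)] [:: mulL (inl a) x].

Lemma word_lcomb_rot1 c s s' s'' :
  word_lcomb c s s' s'' -> word_lcomb c (rot 1 s) (rot 1 s') (rot 1 s'').
Proof.
case=> -[|u s1] s2 x y z h; rewrite /= !rot1_cons -!cats1.
  exact: (WordLcomb s2 [::]).
by rewrite -!catA; exact: (WordLcomb s1 (s2 ++ [:: u])).
Qed.

Lemma word_lcomb_size c s s' s'' : word_lcomb c s s' s'' ->
  size s = size s'' /\ size s' = size s''.
Proof. by case=> s1 s2 x y z _; rewrite !size_cat. Qed.

Lemma word_lcomb_rot c i s s' s'' :
  word_lcomb c s s' s'' -> word_lcomb c (rot i s) (rot i s') (rot i s'').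
Proof.
move=> h; have [e e'] := word_lcomb_size h.
have [|hi] := leqP (size s'') i; first by move=> hi; rewrite !rot_oversize ?e ?e'.
elim: i hi => [|i IH] hi; first by rewrite !rot0.
have rS (u : seq L) : size u = size s'' -> rot i.+1 u = rot 1 (rot i u).
  by move=> eu; rewrite rotS // eu ltnW.
by rewrite !rS //; apply: word_lcomb_rot1; apply: IH; exact: ltnW.
Qed.

Lemma word_lcomb_contract0 op c s s' s'' : contraction_op op ->
  word_lcomb c s s' s'' -> (1 < size s'')%N ->
  word_lcomb c (contract op 0 s) (contract op 0 s') (contract op 0 s'').
Proof.
move=> hop [[|u [|v s1]] s2 x y z h] /=.
- case: s2 => [|v s2] // _; rewrite !contract0; apply: (@WordLcomb c [::]).
  exact: (cop_linl hop).
- move=> _; rewrite !contract0; apply: (@WordLcomb c [::]); exact: (cop_linr hop).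
- by move=> _; rewrite !contract0; exact: (WordLcomb (op u v :: s1)).
Qed.

Lemma word_lcomb_contract op c j s s' s'' : contraction_op op ->
  word_lcomb c s s' s'' -> (1 < size s'')%N -> (j < size s'')%N ->
  word_lcomb c (contract op j s) (contract op j s') (contract op j s'').
Proof.
move=> hop h s1 js; have [e e'] := word_lcomb_size h.
have rot_h := word_lcomb_contract0 hop (word_lcomb_rot j h).
rewrite !size_rot in rot_h.
have [js'|] := boolP (j.+1 < size s'')%N.
  rewrite !(contract_rot op (j := j)) ?e ?e' // /rotr !size_contract ?size_rot ?e ?e' ?(ltnW s1) //.
  by apply: word_lcomb_rot; exact: rot_h.
rewrite -leqNgt => sj; have ej : j.+1 = size s'' by apply/eqP; rewrite eqn_leq js sj.
by rewrite !(contract_rot_end op (j := j)) ?e ?e' //; exact: rot_h.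
Qed.

Lemma word_bal_size s s' : word_bal s s' -> size s = size s'.
Proof. by case=> *; rewrite ?size_cat /= ?size_rcons. Qed.

Lemma word_bal_rot1 s s' : word_bal s s' -> word_bal (rot 1 s) (rot 1 s').
Proof.
case=> [[|u s1] s2 x y a Ka|x r y a Ka|x a Ka]; rewrite /= ?rot1_cons.
- exact: WordBalEnd.
- by rewrite -!cats1 -!catA; exact: (WordBal s1 (s2 ++ [:: u])).
- by rewrite -!cats1 -!catA; exact: (WordBal r [::]).
- exact: WordBal1.
Qed.

Lemma word_bal_rot i s s' : word_bal s s' -> word_bal (rot i s) (rot i s').
Proof.
move=> h; have e := word_bal_size h.
have [|hi] := leqP (size s') i; first by move=> hi; rewrite !rot_oversize ?e.
elim: i hi => [|i IH] hi; first by rewrite !rot0.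
have rS (u : seq L) : size u = size s' -> rot i.+1 u = rot 1 (rot i u).
  by move=> eu; rewrite rotS // eu ltnW.
by rewrite !rS //; apply: word_bal_rot1; apply: IH; exact: ltnW.
Qed.

Lemma word_bal_contract0 op s s' : contraction_op op ->
  word_bal s s' -> (1 < size s')%N ->
  contract op 0 s = contract op 0 s' \/ word_bal (contract op 0 s) (contract op 0 s').
Proof.
move=> hop [[|u [|v s1]] s2 x y a Ka|x [|u r] y a Ka|//] _; rewrite /= ?contract0.
- by left; rewrite (cop_bal hop).
- by right; rewrite (cop_mulr hop); exact: (WordBal [::]).
- by right; exact: (WordBal (op u v :: s1)).
- by right; rewrite (cop_mulr hop) -(cop_mull hop); exact: WordBal1.
- by right; rewrite -(cop_mull hop); exact: WordBalEnd.
Qed.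

Lemma word_bal_contract op j s s' : contraction_op op ->
  word_bal s s' -> (1 < size s')%N -> (j < size s')%N ->
  contract op j s = contract op j s' \/ word_bal (contract op j s) (contract op j s').
Proof.
move=> hop h s1 js; have e := word_bal_size h.
have rot_h := word_bal_contract0 hop (word_bal_rot j h).
rewrite !size_rot in rot_h.
have [js'|] := boolP (j.+1 < size s')%N.
  rewrite !(contract_rot op (j := j)) ?e // /rotr !size_contract ?size_rot ?e ?(ltnW s1) //.
  by case: (rot_h s1) => [->|b]; [left | right; exact: word_bal_rot].
rewrite -leqNgt => sj; have ej : j.+1 = size s' by apply/eqP; rewrite eqn_leq js sj.
by rewrite !(contract_rot_end op (j := j)) ?e //; exact: rot_h.
Qed.

(** * Maps on tensors *)

Section Tensorial.
Variables (v w : nat).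

(** A function of words compatible with the relations between tensors in X_{vw}; it
    induces a linear map on X_{vw}. Its values on other words do not matter. *)
Record tensorial (Y : lmodType k) (F : seq L -> Y) : Prop := {
  tensorial_lcomb : forall c s s' s'', word_lcomb c s s' s'' -> is_word v w s'' ->
    F s'' = c *: F s + F s';
  tensorial_inK : forall s, word_inK s -> is_word v w s -> F s = 0;
  tensorial_bal : forall s s', word_bal s s' -> is_word v w s -> F s = F s' }.

(** Being a word of type (v, w) depends only on the types of the letters. *)
Lemma is_word_shape (s s' : seq L) :
  map (@inA _ _ M) s = map (@inA _ _ M) s' -> is_word v w s = is_word v w s'.
Proof.
have h (r : seq L) : is_word v w r = if map (@inA _ _ M) r is x :: r' then
    [&& ~~ x, count id r' == v & count negb r' == w] else false.
  case: r => //= x r; rewrite !count_map; congr [&& _, _ & _]; first by case: x.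
  by congr (_ == _); apply: eq_count; case.
by rewrite !h => ->.
Qed.

Lemma word_lcomb_shape c s s' s'' : word_lcomb c s s' s'' ->
  (is_word v w s = is_word v w s'') * (is_word v w s' = is_word v w s'').
Proof.
by case=> s1 s2 x y z h; split; apply: is_word_shape; rewrite !map_cat /=; case: h.
Qed.

Lemma mulLAr_inA (x : L) a : inA (mulL x (inl a)) = inA x. Proof. by case: x. Qed.
Lemma mulLAl_inA (x : L) a : inA (mulL (inl a) x) = inA x. Proof. by case: x. Qed.

Lemma word_bal_shape s s' : word_bal s s' -> is_word v w s = is_word v w s'.
Proof.
by case=> *; apply: is_word_shape; rewrite ?map_cat /= ?map_rcons ?mulLAr_inA ?mulLAl_inA.
Qed.

Lemma size_word (s : seq L) : is_word v w s -> size s = (v + w).+1.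
Proof.
case: s => //= x s /and3P[_ /eqP <- /eqP <-]; congr _.+1.
rewrite -(count_predC (@inA _ _ M)); congr addn; apply: eq_count; by case.
Qed.

Lemma gen_word (s : seq L) (hs : is_word v w s) :
  gen v w s = << (Sub s hs : word M v w) >>.
Proof. by rewrite /gen insubT. Qed.

Lemma gen_nonword (s : seq L) : ~~ is_word v w s -> gen v w s = 0.
Proof. by rewrite /gen => hs; rewrite insubN. Qed.

Lemma free_ext_gen (Y : lmodType k) (F : seq L -> Y) s :
  free_ext (fun u : word M v w => F (val u)) (gen v w s)
  = if is_word v w s then F s else 0.
Proof.
case: ifPn => hs; last by rewrite gen_nonword // linear0.
by rewrite gen_word free_extU SubK.
Qed.

Lemma free_ext_relator (Y : lmodType k) (F : seq L -> Y) r :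
  tensorial F -> relator K r -> free_ext (fun u : word M v w => F (val u)) r = 0.
Proof.
move=> hF; case=> {r}.
- move=> s1 s2 c a a'; have h := WordLcomb s1 s2 (LcombA c a a').
  rewrite (linearB (free_ext _)) (linearP (free_ext _)) /= !free_ext_gen !(word_lcomb_shape h).
  case: ifP => hs; last by rewrite scaler0 addr0 subrr.
  by rewrite (tensorial_lcomb hF h) // subrr.
- move=> s1 s2 c a a'; have h := WordLcomb s1 s2 (LcombM c a a').
  rewrite (linearB (free_ext _)) (linearP (free_ext _)) /= !free_ext_gen !(word_lcomb_shape h).
  case: ifP => hs; last by rewrite scaler0 addr0 subrr.
  by rewrite (tensorial_lcomb hF h) // subrr.
- move=> s1 s2 a Ka; rewrite free_ext_gen; case: ifP => // hs.
  exact: (tensorial_inK hF (WordInK s1 s2 Ka)).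
- move=> s1 s2 x y a Ka; have h := WordBal s1 s2 x y Ka.
  rewrite (linearB (free_ext _)) /= !free_ext_gen (word_bal_shape h); case: ifP => hs;
    last exact: subrr.
  by rewrite (tensorial_bal hF h) ?subrr // (word_bal_shape h).
- move=> x a Ka; have h := WordBal1 x Ka.
  rewrite (linearB (free_ext _)) /= !free_ext_gen (word_bal_shape h); case: ifP => hs;
    last exact: subrr.
  by rewrite (tensorial_bal hF h) ?subrr // (word_bal_shape h).
- move=> x s y a Ka; have h := WordBalEnd x s y Ka.
  rewrite (linearB (free_ext _)) /= !free_ext_gen (word_bal_shape h); case: ifP => hs;
    last exact: subrr.
  by rewrite (tensorial_bal hF h) ?subrr // (word_bal_shape h).
Qed.

Lemma free_ext_span (Y : lmodType k) (F : seq L -> Y) r :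
  tensorial F -> Defs.span (@relator _ _ M K v w) r ->
  free_ext (fun u : word M v w => F (val u)) r = 0.
Proof.
move=> hF; elim=> [|c u r' hu _ IH]; first exact: linear0.
by rewrite linearP /= IH free_ext_relator // scaler0 addr0.
Qed.

Section OnTensors.
Variables (Y : lmodType k) (F : seq L -> Y).
Hypothesis hF : tensorial F.

Lemma on_tensors_class (g : {malg k[word M v w]}) :
  on_tensors F (class_of (@relator _ _ M K v w) g : X M K v w)
  = free_ext (fun u : word M v w => F (val u)) g.
Proof.
apply/eqP; rewrite -subr_eq0 -[on_tensors _ _]/(free_ext (fun u : word M v w => F (val u)) _).
by rewrite -linearB /= free_ext_span //; exact: repr_class_of.
Qed.

Lemma on_tensorsE s : is_word v w s -> on_tensors F (tensor K v w s) = F s.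
Proof. by move=> hs; rewrite /tensor on_tensors_class free_ext_gen hs. Qed.

Lemma on_tensors_linear : linear (on_tensors F : X M K v w -> Y).
Proof.
move=> c x y; have [g ->] := class_of_surj x; have [h ->] := class_of_surj y.
rewrite -(class_ofZ (@relator _ _ M K v w)) -class_ofD !on_tensors_class;
  exact: (linearP (free_ext _)).
Qed.

End OnTensors.

Lemma malg1_gen (u : word M v w) : << u >> = gen v w (val u).
Proof. by rewrite (gen_word (valP u)); congr (<< _ >>); apply: val_inj; rewrite SubK. Qed.

Lemma tensor_ind (P : X M K v w -> Prop) :
  P 0 -> (forall c x y, P x -> P y -> P (c *: x + y)) ->
  (forall s, is_word v w s -> P (tensor K v w s)) -> forall x, P x.
Proof.
move=> P0 Plin Pt x; have [g ->] := class_of_surj x; rewrite (monalgE g).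
elim: (enum_fset (msupp g)) => [|u us IH]; first by rewrite big_nil class_of0.
rewrite big_cons class_ofD class_of_malgU malg1_gen.
exact: Plin (Pt _ (valP u)) IH.
Qed.

Lemma tensor_lcomb c s s' s'' : word_lcomb c s s' s'' ->
  tensor K v w s'' = c *: tensor K v w s + tensor K v w s'.
Proof.
case=> s1 s2 x y z h; apply/eqP; rewrite -subr_eq0 /tensor.
rewrite -(class_ofZ (@relator _ _ M K v w)) -class_ofD -class_ofB class_of_rel //.
by case: h => *; [exact: rel_linA | exact: rel_linM].
Qed.

Lemma tensor_inK s : word_inK s -> tensor (M := M) K v w s = 0.
Proof. by case=> s1 s2 a Ka; apply: class_of_rel; exact: rel_K. Qed.

Lemma tensor_bal s s' : word_bal s s' -> tensor K v w s = tensor K v w s'.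
Proof.
move=> h; apply/eqP; rewrite -subr_eq0 /tensor -class_ofB class_of_rel //.
by case: h => *; [exact: rel_balanced | exact: rel_cyclic | exact: rel_cyclic1].
Qed.

Lemma tensor_nonword s : ~~ is_word v w s -> tensor (M := M) K v w s = 0.
Proof. by move=> hs; rewrite /tensor gen_nonword // class_of0. Qed.

End Tensorial.
End Tensors.

Section Maps.
Variables (k : comNzRingType) (A : algType k) (M : bimodule A).
Variables (tri : M -> M -> M) (K : {pred A}).
Hypothesis htri : assoc_product tri.

Notation L := (letter M).
Notation T v w := (tensor (M := M) K v w).
Notation mul := (@mulL k A M).
Notation trl := (triL tri).

(** * Words with a zero letter *)

Lemma tensor_zero v w s : letter0 M \in s -> T v w s = 0.
Proof.
case/splitPr => s1 s2; set s0 := s1 ++ _.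
have h : word_lcomb 1 s0 s0 s0 by apply: WordLcomb; exact: lcomb0.
by apply: (addrI (T v w s0)); rewrite addr0 -{1}[T v w s0]scale1r -(tensor_lcomb K v w h).
Qed.

Lemma last_split (s : seq L) j : j.+1 = size s -> (1 < size s)%N ->
  exists x r y, s = x :: rcons r y /\ j = (size r).+1.
Proof.
move=> ej /split_ends[x [r [y e]]]; exists x, r, y; split=> //.
by move: ej; rewrite e /= size_rcons => -[].
Qed.

Lemma contract_cases (s : seq L) j : (1 < size s)%N -> (j < size s)%N ->
  (exists s1 x y s2, s = s1 ++ x :: y :: s2 /\ j = size s1) \/
  (exists x r y, s = x :: rcons r y /\ j = (size r).+1).
Proof.
move=> s1 js; have [js'|sj] := ltnP j.+1 (size s); first by left; exact: split_at2.
by right; apply: last_split => //; apply/eqP; rewrite eqn_leq js sj.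
Qed.

Lemma contract_zero op j (s : seq L) : contraction_op op -> letter0 M \in s ->
  (1 < size s)%N -> (j < size s)%N -> letter0 M \in contract op j s.
Proof.
move=> hop + s1 js; case: (contract_cases s1 js) => [[u [x [y [r [-> ->]]]]]|[x [r [y [-> ->]]]]].
  rewrite contract_mid !mem_cat !in_cons; case/or4P => [->|/eqP<-|/eqP<-|->];
    by rewrite ?(cop_0l hop) ?(cop_0r hop) ?eqxx ?orbT.
rewrite contract_end in_cons mem_rcons !in_cons; case/or3P => [/eqP<-|/eqP<-|->];
  by rewrite ?(cop_0l hop) ?(cop_0r hop) ?eqxx ?orbT.
Qed.

Lemma is_wordE v w (s : seq L) :
  is_word v w s = [&& inM (head (inl 0 : L) s), count (@inA _ _ M) s == v
                    & count (@inM _ _ M) s == w.+1].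
Proof. by case: s => [|[a|m] s] //=. Qed.

Lemma head_contract op j (s : seq L) : contraction_op op -> (1 < size s)%N -> (j < size s)%N ->
  inM (head (inl 0 : L) s) -> inM (head (inl 0 : L) (contract op j s)).
Proof.
move=> hop s1 js; case: (contract_cases s1 js) =>
  [[[|h u] [x [y [r [-> ->]]]]]|[x [r [y [-> ->]]]]].
- by rewrite (contract_mid op [::]); exact: (cop_inMl hop).
- by rewrite contract_mid.
- by rewrite contract_end; exact: (cop_inMr hop).
Qed.

(** Contracting two letters of M by [mulL], or two letters not both in M by [triL], gives
    a zero letter; any other contraction has the expected type. *)
Lemma contract_mul_word v w j (s : seq L) : is_word v.+1 w s -> (1 < size s)%N -> (j < size s)%N ->
  is_word v w (contract mul j s) || (letter0 M \in contract mul j s).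
Proof.
rewrite !is_wordE => /and3P[hs /eqP cA /eqP cM] s1 js.
rewrite (head_contract (@mulL_contraction _ _ M)) //=.
move: cA cM; case: (contract_cases s1 js) => [[u [x [y [r [-> ->]]]]]|[x [r [y [-> ->]]]]].
  rewrite contract_mid !count_cat mem_cat in_cons /=.
  by case: x y => [a|m] [b|n] /=; rewrite ?eqxx ?orbT // => cA cM;
    apply/orP; left; apply/andP; split; apply/eqP; lia.
rewrite contract_end /= -cats1 !count_cat in_cons /=.
by case: x y => [a|m] [b|n] /=; rewrite ?eqxx ?orbT // => cA cM;
    apply/orP; left; apply/andP; split; apply/eqP; lia.
Qed.

Lemma contract_tri_word v w j (s : seq L) : is_word v w.+1 s -> (1 < size s)%N -> (j < size s)%N ->
  is_word v w (contract trl j s) || (letter0 M \in contract trl j s).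
Proof.
rewrite !is_wordE => /and3P[hs /eqP cA /eqP cM] s1 js.
rewrite (head_contract (triL_contraction htri)) //=.
move: cA cM; case: (contract_cases s1 js) => [[u [x [y [r [-> ->]]]]]|[x [r [y [-> ->]]]]].
  rewrite contract_mid !count_cat mem_cat in_cons /=.
  by case: x y => [a|m] [b|n] /=; rewrite ?eqxx ?orbT // => cA cM;
    apply/orP; left; apply/andP; split; apply/eqP; lia.
rewrite contract_end /= -cats1 !count_cat in_cons /=.
by case: x y => [a|m] [b|n] /=; rewrite ?eqxx ?orbT // => cA cM;
    apply/orP; left; apply/andP; split; apply/eqP; lia.
Qed.

(** * Well-definedness of the contraction sums *)

(** The alternating sum of the first m contractions of a word, as a tensor. *)
Definition contraction_sum op v w m (s : seq L) : X M K v w :=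
  \sum_(j < m) (-1) ^+ j *: T v w (contract op j s).

Lemma contraction_sum_zero op v w m (s : seq L) : contraction_op op -> letter0 M \in s ->
  (1 < size s)%N -> (m <= size s)%N -> contraction_sum op v w m s = 0.
Proof.
move=> hop hs s1 ms; apply: big1 => j _.
by rewrite tensor_zero ?scaler0 // contract_zero // (leq_trans (ltn_ord j) ms).
Qed.

Lemma contraction_sum_tensorial op v w v' w' (m : nat -> nat) : contraction_op op ->
  (0 < v + w)%N -> (forall n, (m n <= n)%N) ->
  (forall s, word_inK K s -> is_word v w s -> contraction_sum op v' w' (m (size s)) s = 0) ->
  tensorial K v w (fun s => contraction_sum op v' w' (m (size s)) s).
Proof.
move=> hop vw hm hK; split=> // [c s s' s'' h hs|s s' h hs].
- have [e e'] := word_lcomb_size h; have sz := size_word hs.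
  rewrite e e' /contraction_sum scaler_sumr -big_split /=; apply: eq_bigr => j _.
  have hj : word_lcomb c (contract op j s) (contract op j s') (contract op j s'').
    apply: word_lcomb_contract => //; first by rewrite sz.
    exact: leq_trans (ltn_ord j) (hm _).
  by rewrite (tensor_lcomb K v' w' hj) scalerDr !scalerA mulrC.
- have e := word_bal_size h; have sz := size_word hs.
  rewrite e /contraction_sum; apply: eq_bigr => j _.
  have [||->//|hj] := word_bal_contract (j := j) hop h; first by rewrite -e sz.
    exact: leq_trans (ltn_ord j) (hm _).
  by rewrite (tensor_bal v' w' hj).
Qed.

(** Membership of a letter in K. *)
Definition letter_inK (x : L) : bool := if x is inl a then a \in K else false.

Lemma word_inKP (s : seq L) : has letter_inK s -> word_inK K s.
Proof. by case/hasP=> -[a|//] /splitPr[u r] Ka; exact: WordInK. Qed.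

Lemma has_inK (s : seq L) : word_inK K s -> has letter_inK s.
Proof. by case=> u r a Ka; rewrite has_cat /= Ka orbT. Qed.

Lemma tri_inK v' w' j s : word_inK K s -> (1 < size s)%N -> (j < size s)%N ->
  T v' w' (contract trl j s) = 0.
Proof.
move=> /has_inK h s1 js.
have : has letter_inK (contract trl j s) || (letter0 M \in contract trl j s).
  case: (contract_cases s1 js) h => [[u [x [y [r [-> ->]]]]]|[x [r [y [-> ->]]]]].
    rewrite contract_mid mem_cat in_cons !has_cat /=.
    by case/or4P => [->//|||->]; rewrite ?orbT //;
      case: x y => [a|m] [b|n] //=; rewrite eqxx ?orbT.
  rewrite contract_end in_cons /= has_rcons.
  by case/or3P => [||->]; rewrite ?orbT //; case: x y => [a|m] [b|n] //=; rewrite eqxx ?orbT.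
case/orP => [/word_inKP/(tensor_inK v' w')|/(tensor_zero v' w')] //.
Qed.

Lemma contract_has_inK op p j (s : seq L) : (j < size s)%N -> (1 < size s)%N ->
  (0 < p < size s)%N -> p != j -> p != j.+1 ->
  letter_inK (nth (letter0 M) s p) -> has letter_inK (contract op j s).
Proof.
move=> js s1 /andP[p0 ps] pj pj' hp; rewrite /contract; case: ifP => js'.
  rewrite has_cat /=; have [lpj|ljp] := ltnP p j.
    apply/orP; left; apply/(has_nthP (letter0 M)); exists p; last by rewrite nth_take.
    by rewrite size_takel // ltnW.
  apply/orP; right; apply/orP; right; apply/(has_nthP (letter0 M)); exists (p - j.+2)%N.
    by rewrite size_drop ltn_sub2r //; lia.
  by rewrite nth_drop subnKC //; lia.
rewrite /=; apply/orP; right; apply/(has_nthP (letter0 M)); exists p.-1.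
  by rewrite size_behead size_takel; lia.
by rewrite nth_behead prednK // nth_take //; lia.
Qed.

(** The two contractions involving a letter of K cancel, and all others contain it. *)
Lemma mul_inK v w v' w' s : word_inK K s -> is_word v w s -> (0 < v + w)%N ->
  contraction_sum mul v' w' (size s) s = 0.
Proof.
case=> s1 s2 a Ka; case/lastP: s1 => [//|u y] hs vw.
have sz := size_word hs; rewrite size_cat size_rcons /= in sz.
have near : T v' w' (contract mul (size u) (rcons u y ++ inl a :: s2))
            = T v' w' (contract mul (size u).+1 (rcons u y ++ inl a :: s2)).
  rewrite [in LHS]cat_rcons contract_mid.
  case: s2 sz {hs} => [|z s2] sz; last first.
    rewrite -(size_rcons u y) contract_mid cat_rcons; apply: tensor_bal; exact: WordBal.
  case: u sz => [|x u] sz /=.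
    rewrite (contract_end _ _ [::]); apply: tensor_bal; exact: WordBal1.
  rewrite -[RHS]/(T v' w' (contract mul (size u).+2 (x :: (rcons u y ++ [:: inl a])))) cats1.
  rewrite -(size_rcons u y) contract_end cats1; apply: tensor_bal; exact: WordBalEnd.
pose f j := (-1) ^+ j *: T v' w' (contract mul j (rcons u y ++ inl a :: s2)).
apply: (@sum_two_cancel _ _ _ (size u) f); rewrite /f.
- by rewrite size_cat size_rcons /= addSn addnS !ltnS leq_addr.
- move=> j js jp jp'; apply/eqP; rewrite tensor_inK ?scaler0 //; apply: word_inKP.
  apply: (@contract_has_inK _ (size u).+1 j _ js).
  + by rewrite size_cat size_rcons /=; lia.
  + by rewrite size_cat size_rcons /= -[X in (X < _)%N]addn0 ltn_add2l.
  + by rewrite eq_sym.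
  + by rewrite eqSS eq_sym.
  + by rewrite nth_cat size_rcons ltnn subnn.
- rewrite near exprS mulN1r scaleNr subrr //.
Qed.

(** * Evaluation of the differentials on tensors *)

Notation wordz v w s := (is_word v w s || (letter0 M \in s)).

(** A contraction sum is a well-defined map, also evaluated correctly on words with a
    zero letter, whatever their type. *)
Lemma on_contraction_sum op v w v' w' (m : nat -> nat) (s : seq L) : contraction_op op ->
  (0 < v + w)%N -> (forall n, (m n <= n)%N) ->
  (forall s, word_inK K s -> is_word v w s -> contraction_sum op v' w' (m (size s)) s = 0) ->
  is_word v w s || (letter0 M \in s) -> (1 < size s)%N ->
  on_tensors (fun s => contraction_sum op v' w' (m (size s)) s) (T v w s)
  = contraction_sum op v' w' (m (size s)) s.
Proof.
move=> hop vw hm hK hs s1; have hF := contraction_sum_tensorial hop vw hm hK.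
have [ws|nws] := boolP (is_word v w s); first exact: (on_tensorsE hF).
rewrite (negbTE nws) /= in hs.
rewrite tensor_nonword // contraction_sum_zero //.
exact: linear_zero (on_tensors_linear hF).
Qed.

Fact tri_sum_inK v w v' w' (m : nat -> nat) : (0 < v + w)%N -> (forall n, (m n <= n)%N) ->
  forall s, word_inK K s -> is_word v w s -> contraction_sum trl v' w' (m (size s)) s = 0.
Proof.
move=> vw hm s hs ws; apply: big1 => j _; rewrite tri_inK ?scaler0 //.
  by rewrite (size_word ws).
exact: leq_trans (ltn_ord j) (hm _).
Qed.

Fact mul_sum_inK v w v' w' : (0 < v + w)%N ->
  forall s, word_inK K s -> is_word v w s -> contraction_sum mul v' w' (size s) s = 0.
Proof. by move=> vw s hs ws; exact: (mul_inK v' w' hs ws). Qed.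

(** The contraction e of the first two letters by the product of M. The bound [minn 1 _]
    presents it as a contraction sum with a single term. *)
Definition e0X v w : X M K v w.+1 -> X M K v w :=
  on_tensors (fun s => contraction_sum trl v w (minn 1 (size s)) s).

Fact vw1 v w : (0 < v + w.+1)%N. Proof. by rewrite addnS. Qed.
Fact v1w v w : (0 < v.+1 + w)%N. Proof. by []. Qed.

Lemma bX_tensor v w s : wordz v.+1 w s -> (1 < size s)%N ->
  bX (T v.+1 w s) = contraction_sum mul v w (size s) s.
Proof.
exact: (@on_contraction_sum mul v.+1 w v w id _ (@mulL_contraction _ _ M) isT (fun=> leqnn _)
  (@mul_sum_inK v.+1 w v w isT)).
Qed.

Lemma dX_tensor v w s : wordz v w.+1 s -> (1 < size s)%N ->
  dX tri (T v w.+1 s) = contraction_sum trl v w (size s) s :> X M K v w.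
Proof.
exact: (@on_contraction_sum trl v w.+1 v w id _ (triL_contraction htri) (vw1 v w)
  (fun=> leqnn _) (@tri_sum_inK v w.+1 v w id (vw1 v w) (fun=> leqnn _))).
Qed.

Lemma dX'_tensor v w s : wordz v w.+1 s -> (1 < size s)%N ->
  dX' tri (T v w.+1 s) = contraction_sum trl v w (size s).-1 s :> X M K v w.
Proof.
exact: (@on_contraction_sum trl v w.+1 v w predn _ (triL_contraction htri) (vw1 v w)
  (fun=> leq_pred _) (@tri_sum_inK v w.+1 v w predn (vw1 v w) (fun=> leq_pred _))).
Qed.

Lemma e0X_tensor v w s : wordz v w.+1 s -> (1 < size s)%N ->
  e0X (T v w.+1 s) = T v w (contract trl 0 s).
Proof.
move=> hs s1.
have := (@on_contraction_sum trl v w.+1 v w (minn 1) _ (triL_contraction htri) (vw1 v w)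
  (fun=> geq_minr _ _) (@tri_sum_inK v w.+1 v w (minn 1) (vw1 v w) (fun=> geq_minr _ _)) hs s1).
rewrite -[LHS]/(e0X _) => ->; rewrite (minn_idPl (ltnW s1)) /contraction_sum.
by rewrite big_ord_recl big_ord0 addr0 scale1r.
Qed.

Lemma bX_linear v w : linear (@bX k A M K v w).
Proof.
exact: (on_tensors_linear (contraction_sum_tensorial (m := id) (@mulL_contraction _ _ M) (v1w v w)
  (fun=> leqnn _) (@mul_sum_inK v.+1 w v w isT))).
Qed.

Lemma dX_linear v w : linear (@dX k A M tri K v w.+1).
Proof.
exact: (on_tensors_linear (contraction_sum_tensorial (m := id) (triL_contraction htri) (vw1 v w)
  (fun=> leqnn _) (@tri_sum_inK v w.+1 v w id (vw1 v w) (fun=> leqnn _)))).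
Qed.

Lemma dX'_linear v w : linear (@dX' k A M tri K v w.+1).
Proof.
exact: (on_tensors_linear (contraction_sum_tensorial (m := predn) (triL_contraction htri) (vw1 v w)
  (fun=> leq_pred _) (@tri_sum_inK v w.+1 v w predn (vw1 v w) (fun=> leq_pred _)))).
Qed.

Lemma e0X_linear v w : linear (@e0X v w).
Proof.
exact: (on_tensors_linear (contraction_sum_tensorial (m := minn 1) (triL_contraction htri) (vw1 v w)
  (fun=> geq_minr _ _) (@tri_sum_inK v w.+1 v w (minn 1) (vw1 v w) (fun=> geq_minr _ _)))).
Qed.

(** * The presimplicial identities *)

(** Two contractions of a word either commute, or they bracket three consecutive
    letters in the two possible ways. *)
Lemma contract_contract (s : seq L) i j : (2 < size s)%N -> (i < j)%N -> (j < size s)%N ->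
  [\/ forall o1 o2, contract o1 i (contract o2 j s) = contract o2 j.-1 (contract o1 i s),
      exists s1 x y z s2, forall o1 o2,
        contract o1 i (contract o2 j s) = s1 ++ o1 x (o2 y z) :: s2 /\
        contract o1 j.-1 (contract o2 i s) = s1 ++ o1 (o2 x y) z :: s2
    | exists s1 x y z s2, forall o1 o2,
        contract o1 i (contract o2 j s) = s1 ++ o1 (o2 x y) z :: s2 /\
        contract o1 j.-1 (contract o2 i s) = s1 ++ o1 x (o2 y z) :: s2].
Proof.
move=> s2 ij js; case: (contract_cases (ltnW s2) js) =>
  [[u [y [z [r [es ej]]]]]|[x [r [y [es ej]]]]].
  have [i1|i1] := ltnP i.+1 j; last first.
    have eij : j = i.+1 by apply/eqP; rewrite eqn_leq ij i1.
    apply: Or32; case/lastP: u es ej => [|u x] es ej; first by rewrite ej in ij.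
    have ei : i = size u by move: ej; rewrite size_rcons eij => -[].
    exists u, x, y, z, r => o1 o2; rewrite eij /= es {es} -{1}eij ej contract_mid.
    by rewrite !cat_rcons ei !contract_mid.
  apply: Or31 => o1 o2; rewrite ej in i1; have [p [a [b [q [eu ei]]]]] := split_at2 i1.
  rewrite es ej contract_mid eu -!catA ei !contract_mid !size_cat /= !addnS /=.
  have -> : ((size p + size q).+1 = size (p ++ o1 a b :: q))%N by rewrite size_cat /= addnS.
  by rewrite -!cat_cons !catA !contract_mid -!catA.
move: s2; rewrite es ej /= size_rcons => s2; rewrite ej in ij.
have [i0|i0] := posnP i.
  apply: Or33; rewrite i0; case: r es ej ij s2 => // z r es ej ij s2.
  exists [::], y, x, z, r => o1 o2.
  by rewrite contract_end /= !contract0 contract_end.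
have [ir|ir] := ltnP i (size r).
  apply: Or31 => o1 o2; case: i i0 ir ij => // i _ ir ij.
  have [p [a [b [q [eu ei]]]]] := split_at2 ir.
  rewrite contract_end eu ei -!cat_cons (contract_mid o1 (_ :: p)) rcons_cat !rcons_cons.
  rewrite -[x :: p ++ _]/((x :: p) ++ _) (contract_mid o1 (x :: p)) /= -rcons_cons -rcons_cat.
  have -> : (size (p ++ [:: a, b & q]) = (size (p ++ o1 a b :: q)).+1)%N.
    by rewrite !size_cat /= !addnS.
  by rewrite contract_end.
have ei : i = size r by apply/eqP; rewrite eqn_leq ir -ltnS ij.
apply: Or32; case/lastP: r es ej ij s2 i0 ir ei => [|r z] es ej ij s2 i0 ir ei.
  by rewrite ei in i0.
exists [::], z, y, x, r => o1 o2; rewrite ei contract_end !size_rcons contract_end.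
have -> : x :: rcons (rcons r z) y = (x :: r) ++ [:: z; y].
  by rewrite -!cats1 -catA.
by rewrite (contract_mid o2 (x :: r)) cats1 rcons_cons contract_end.
Qed.

Lemma linear_contraction_sum op1 op2 v w v' w' m m' (s : seq L)
    (f : X M K v w -> X M K v' w') : linear f ->
  (forall j, (j < m)%N ->
     f (T v w (contract op1 j s)) = contraction_sum op2 v' w' m' (contract op1 j s)) ->
  f (contraction_sum op1 v w m s)
  = \sum_(j < m) (-1) ^+ j *:
      \sum_(i < m') (-1) ^+ i *: T v' w' (contract op2 i (contract op1 j s)).
Proof.
move=> lf hf; rewrite /contraction_sum (linear_lcomb_sum _ _ lf).
apply: eq_bigr => j _; rewrite hf //.
Qed.

Lemma linear_eq (v w : nat) (Y : lmodType k) (f g : X M K v w -> Y) :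
  linear f -> linear g -> (forall s, is_word v w s -> f (T v w s) = g (T v w s)) ->
  forall x, f x = g x.
Proof.
move=> lf lg h; apply: tensor_ind => // [|c x y fx fy].
  by rewrite (linear_zero lf) (linear_zero lg).
by rewrite lf lg fx fy.
Qed.

(** Contractions by an associative product. *)
Lemma assoc_contractions v w op m (s : seq L) : associative op ->
  (2 < size s)%N -> (m < size s)%N ->
  \sum_(j < m.+1) (-1) ^+ j *:
    \sum_(i < m) (-1) ^+ i *: T v w (contract op i (contract op j s)) = 0.
Proof.
move=> opA s2 ms; apply: (presimplicial_sum
  (f := fun i j => T v w (contract op i (contract op j s)))) => i j ij jm.
case: (contract_contract s2 ij (leq_ltn_trans jm ms)) => [->//||].
  by case=> [s1 [x [y [z [r /(_ op op)[-> ->]]]]]]; rewrite opA.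
by case=> [s1 [x [y [z [r /(_ op op)[-> ->]]]]]]; rewrite opA.
Qed.

(** The two products of letters are the two terms of an associative product. *)
Lemma mixed_assoc v w s1 (x y z : L) s2 :
  T v w (s1 ++ mul x (trl y z) :: s2) + T v w (s1 ++ trl x (mul y z) :: s2)
  = T v w (s1 ++ mul (trl x y) z :: s2) + T v w (s1 ++ trl (mul x y) z :: s2).
Proof.
have T0 : T v w (s1 ++ letter0 M :: s2) = 0.
  by apply: tensor_zero; rewrite mem_cat in_cons eqxx orbT.
case: x y z => [a|m] [b|n] [c|p] //=;
  rewrite ?ract0 ?lact0 -?/(letter0 M) ?(tri0m htri) ?(trim0 htri) -?/(letter0 M) ?T0 ?addr0
  ?add0r //.
- by rewrite (tri_lact htri).
- by rewrite (tri_balanced htri).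
- by rewrite (tri_ract htri).
Qed.

Lemma mixed_contractions v w m (s : seq L) : (2 < size s)%N -> (m < size s)%N ->
  \sum_(j < m.+1) (-1) ^+ j *:
     \sum_(i < m) (-1) ^+ i *: T v w (contract mul i (contract trl j s))
  + \sum_(j < m.+1) (-1) ^+ j *:
     \sum_(i < m) (-1) ^+ i *: T v w (contract trl i (contract mul j s)) = 0.
Proof.
move=> s2 ms; pose f i j := T v w (contract mul i (contract trl j s))
                            + T v w (contract trl i (contract mul j s)).
rewrite -[RHS](@presimplicial_sum _ _ m f).
  rewrite -big_split /=; apply: eq_bigr => j _; rewrite -scalerDr -big_split /=.
  by congr (_ *: _); apply: eq_bigr => i _; rewrite -scalerDr.
move=> i j ij jm; rewrite /f.
case: (contract_contract s2 ij (leq_ltn_trans jm ms)) => [h||].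
- by rewrite !h addrC.
- case=> [s1 [x [y [z [r h]]]]]; have [-> ->] := h mul trl; have [-> ->] := h trl mul.
  exact: mixed_assoc.
- case=> [s1 [x [y [z [r h]]]]]; have [-> ->] := h mul trl; have [-> ->] := h trl mul.
  by rewrite mixed_assoc.
Qed.

Lemma bX_bX v w (x : X M K v.+2 w) : bX (bX x) = 0.
Proof.
apply: (linear_eq (linear_comp (@bX_linear v w) (@bX_linear v.+1 w)) (@linear_zero_fun k _ _)) =>
  s hs.
have sz := size_word hs.
rewrite bX_tensor ?hs //; last by rewrite sz.
rewrite (linear_contraction_sum (op2 := mul) (m' := (size s).-1) (@bX_linear v w)).
  by rewrite sz; apply: assoc_contractions; [exact: mulLA | rewrite sz | rewrite sz].
move=> j js; have s1 : (1 < size s)%N by rewrite sz.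
  have sc := size_contract mul s1 js.
  by rewrite bX_tensor ?sc ?sz ?contract_mul_word.
Qed.

Lemma dX_dX v w (x : X M K v w.+2) : dX tri (dX tri x : X M K v w.+1) = 0 :> X M K v w.
Proof.
apply: (linear_eq (linear_comp (@dX_linear v w) (@dX_linear v w.+1)) (@linear_zero_fun k _ _)) =>
  s hs.
have sz : size s = (v + w).+3 by rewrite (size_word hs) !addnS.
rewrite dX_tensor ?hs //; last by rewrite sz.
rewrite (linear_contraction_sum (op2 := trl) (m' := (size s).-1) (@dX_linear v w)).
  by rewrite sz; apply: assoc_contractions; [exact: triLA | rewrite sz | rewrite sz].
move=> j js; have s1 : (1 < size s)%N by rewrite sz.
  have sc := size_contract trl s1 js.
  by rewrite dX_tensor ?sc ?sz ?contract_tri_word.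
Qed.

Lemma dX'_dX' v w (x : X M K v w.+2) : dX' tri (dX' tri x : X M K v w.+1) = 0 :> X M K v w.
Proof.
apply: (linear_eq (linear_comp (@dX'_linear v w) (@dX'_linear v w.+1)) (@linear_zero_fun k _ _)) =>
  s hs.
have sz : size s = (v + w).+3 by rewrite (size_word hs) !addnS.
rewrite dX'_tensor ?hs //; last by rewrite sz.
rewrite (linear_contraction_sum (op2 := trl) (m' := (size s).-2) (@dX'_linear v w)).
  by rewrite sz; apply: assoc_contractions; [exact: triLA | rewrite sz | rewrite sz ltnW].
move=> j js; have s1 : (1 < size s)%N by rewrite sz.
have js' : (j < size s)%N by apply: leq_trans js (leq_pred _).
have sc := size_contract trl s1 js'.
by rewrite dX'_tensor ?sc ?sz ?contract_tri_word.
Qed.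

Lemma bX_dX v w (x : X M K v.+1 w.+1) :
  bX (dX tri x : X M K v.+1 w) + dX tri (bX x) = 0 :> X M K v w.
Proof.
apply: (linear_eq (linear_add (linear_comp (@bX_linear v w) (@dX_linear v.+1 w))
  (linear_comp (@dX_linear v w) (@bX_linear v w.+1))) (@linear_zero_fun k _ _)) => s hs.
have sz : size s = (v + w).+3 by rewrite (size_word hs) !addnS.
rewrite dX_tensor ?hs ?bX_tensor ?hs ?sz //.
rewrite (linear_contraction_sum (op2 := mul) (m' := (size s).-1) (@bX_linear v w)); last first.
  move=> j; rewrite -sz => js; have s1 : (1 < size s)%N by rewrite sz.
  have sc := size_contract trl s1 js.
  by rewrite bX_tensor ?sc ?sz ?contract_tri_word.
rewrite (linear_contraction_sum (op2 := trl) (m' := (size s).-1) (@dX_linear v w)); last first.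
  move=> j; rewrite -sz => js; have s1 : (1 < size s)%N by rewrite sz.
  have sc := size_contract mul s1 js.
  by rewrite dX_tensor ?sc ?sz ?contract_mul_word.
by rewrite sz; apply: mixed_contractions; rewrite sz.
Qed.

Lemma contract_tri0_mul j (s : seq L) : (2 < size s)%N -> (1 < j < size s)%N ->
  inM (head (inl 0 : L) s) ->
  contract trl 0 (contract mul j s) = contract mul j.-1 (contract trl 0 s).
Proof.
move=> s2 /andP[j1 js].
case: (contract_cases (ltnW s2) js) => [[u [a [b [r [es ej]]]]]|[x [[|z r] [y [es ej]]]]].
- move: u es ej j1 => [|p [|q u]] -> -> //= _ _.
  rewrite (contract_mid _ (p :: q :: u)) !contract0.
  by rewrite (contract_mid mul (trl p q :: u)).
- by rewrite ej in j1.
rewrite es ej contract_end /= !contract0 contract_end.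
by case: x y z {es ej} => [//|m] [a|n] [b|p] //= _; rewrite ?(tri_lact htri) ?lact0 ?(tri0m htri).
Qed.

(** The map e anticommutes with b. *)
Lemma bX_e0X v w (x : X M K v.+1 w.+1) :
  bX (e0X x : X M K v.+1 w) + e0X (bX x) = 0 :> X M K v w.
Proof.
apply: (linear_eq (linear_add (linear_comp (@bX_linear v w) (@e0X_linear v.+1 w))
  (linear_comp (@e0X_linear v w) (@bX_linear v w.+1))) (@linear_zero_fun k _ _)) => s hs.
have sz : size s = (v + w).+3 by rewrite (size_word hs) !addnS.
rewrite e0X_tensor ?hs ?bX_tensor ?hs ?size_contract ?sz //; last first.
  by rewrite contract_tri_word ?sz.
rewrite linear_lcomb_sum; last exact: e0X_linear.
under eq_bigr => j _.
  rewrite e0X_tensor; first over.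
  - by rewrite contract_mul_word -?sz // ?sz.
  - by rewrite size_contract -?sz // ?sz.
apply: (shifted_sum (f := fun i => T v w (contract mul i (contract trl 0 s)))
                    (g := fun j => T v w (contract trl 0 (contract mul j s)))); last first.
  move=> i /andP[i0 iv]; rewrite contract_tri0_mul ?sz ?ltnS ?i0 //.
  by move: hs; rewrite is_wordE => /andP[].
(* What remains is the relation between the contractions of the first three letters. *)
case: s hs sz => [|x0 [|y [|z r]]] //; rewrite is_wordE => /andP[hx _] _.
have e1 : contract mul 1 [:: x0, y, z & r] = [:: x0, mul y z & r].
  exact: (contract_mid mul [:: x0]).
rewrite e1 !contract0 {e1}.
have := mixed_assoc v w [::] x0 y z r; rewrite /= => <-.
rewrite tensor_zero ?add0r //.
by case: x0 hx => // m _; case: y z => [a|n] [b|p]; rewrite /= in_cons eqxx.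
Qed.

End Maps.

Section Cyclic.
Variables (k : comNzRingType) (A : algType k) (M : bimodule A).
Variables (tri : M -> M -> M) (K : {pred A}).
Hypothesis htri : assoc_product tri.

Notation L := (letter M).
Notation T v w := (tensor (M := M) K v w).
Notation mul := (@mulL k A M).
Notation trl := (triL tri).

(** * The cyclic operator on tensors *)

Lemma last_inM_shape (s s' : seq L) :
  map (@inA _ _ M) s = map (@inA _ _ M) s' -> last_inM s = last_inM s'.
Proof.
have h (r : seq L) : last_inM r = (\max_(0 <= i < size (map (@inA _ _ M) r)
    | ~~ nth true (map (@inA _ _ M) r) i) i)%N.
  rewrite size_map big_mkord; apply: eq_bigl => i.
  by rewrite (nth_map (letter0 M)) //; case: nth.
by rewrite !h => ->.
Qed.

Lemma last_inM_block (u : seq L) x r : inM x -> all (@inA _ _ M) r ->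
  last_inM (u ++ x :: r) = size u.
Proof.
move=> hx hr; have us : (size u < size (u ++ x :: r))%N by rewrite size_cat /= addnS ltnS leq_addr.
apply/eqP; rewrite eqn_leq; apply/andP; split; last first.
  apply: (@leq_bigmax_cond _ _ _ (Ordinal us)).
  by rewrite /= nth_cat ltnn subnn.
apply/bigmax_leqP => i; rewrite nth_cat; case: ltnP => [/ltnW //|ui].
case e : (i - size u)%N => [|j] /=; first by rewrite leqNgt -subn_gt0 e.
move=> hM; have jr : (j < size r)%N.
  have : (i < size u + (size r).+1)%N by rewrite -[(size r).+1]/(size (x :: r)) -size_cat.
  by rewrite -{1}(subnK ui) e addnC ltn_add2l ltnS.
by move/all_nthP: hr => /(_ (letter0 M) j jr); case: nth hM.
Qed.

(** The value of the cyclic operator on a word. *)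
Definition t_word v w (s : seq L) : X M K v w :=
  (-1) ^+ (last_inM s * (size s).-1) *: T v w (rot (last_inM s) s).

Lemma t_word_tensorial v w : tensorial K v w (@t_word v w).
Proof.
split=> [c s s' s'' h hs|s /has_inK h hs|s s' h hs]; rewrite /t_word.
- have [e e'] := word_lcomb_size h.
  have [l l'] : last_inM s = last_inM s'' /\ last_inM s' = last_inM s''.
    by case: h => s1 s2 x y z h; split; apply: last_inM_shape; rewrite !map_cat /=; case: h.
  by rewrite e e' l l' (tensor_lcomb K v w (word_lcomb_rot (last_inM s'') h)) scalerDr !scalerA
    mulrC.
- rewrite tensor_inK ?scaler0 //; apply: word_inKP.
  by rewrite /rot has_cat orbC -has_cat cat_take_drop.
- have e := word_bal_size h.
  have -> : last_inM s = last_inM s'.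
    by case: h => *; apply: last_inM_shape; rewrite ?map_cat /= ?map_rcons ?mulLAr_inA ?mulLAl_inA.
  by rewrite e (tensor_bal v w (word_bal_rot _ h)).
Qed.

Lemma tX_linear v w : linear (@tX k A M K v w).
Proof. exact: (on_tensors_linear (@t_word_tensorial v w)). Qed.

Lemma tX_tensor v w s : is_word v w s -> tX (T v w s) = t_word v w s.
Proof. exact: (on_tensorsE (@t_word_tensorial v w)). Qed.

(* These stay folded from here on: tensors are compared through their words. *)
#[local] Opaque X tensor tX.

(** Empty words and words beginning with a letter of M. *)
Definition Mstart (s : seq L) : bool := if s is x :: _ then inM x else true.

(** A block: a letter of M followed by letters of A. *)
Definition block (s : seq L) : bool :=
  if s is x :: r then inM x && all (@inA _ _ M) r else false.

Lemma block_Mstart s : block s -> Mstart s.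
Proof. by case: s => //= x r /andP[]. Qed.

Lemma block_count s : block s -> count (@inM _ _ M) s = 1%N.
Proof.
case: s => //= x r /andP[-> hr]; congr _.+1; apply/eqP; rewrite -leqn0 leqNgt -has_count.
by apply/hasPn => y /(allP hr); case: y.
Qed.

Lemma last_block (s : seq L) : Mstart s -> s != [::] ->
  exists u c, [/\ s = u ++ c, Mstart u & block c].
Proof.
elim/last_ind: s => // s x IH hs _; case hx : (inM x).
  exists s, [:: x]; rewrite cats1 /= hx; split=> //.
  by case: s hs {IH}.
case: s IH hs => [|y s] IH hs; first by rewrite /= hx in hs.
have [//|//|u [c [e hu hc]]] := IH; exists u, (rcons c x); split=> //.
  by rewrite -cats1 e -catA cats1.
by case: c hc {e} => //= z r /andP[-> hr]; rewrite all_rcons hr andbT; case: x hx {hs}.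
Qed.

Lemma is_word_catC v w (u c : seq L) : Mstart u -> Mstart c ->
  is_word v w (u ++ c) = is_word v w (c ++ u).
Proof.
move=> hu hc; rewrite !is_wordE !count_cat ![(count _ u + _)%N]addnC; congr andb.
by case: u hu => [|x u] hu; case: c hc => [|y c] hc; rewrite ?cats0 //=; move: hu hc => /= -> ->.
Qed.

(** The sign of the exchange of two segments. *)
Definition koszul (u c : seq L) : k := (-1) ^+ (size u * size c).

(** The cyclic operator moves the last block to the front, with the Koszul sign. *)
Lemma tX_block v w u c : Mstart u -> block c ->
  tX (T v w (u ++ c)) = koszul u c *: T v w (c ++ u).
Proof.
move=> hu hc; have [ws|nws] := boolP (is_word v w (u ++ c)); last first.
  rewrite !tensor_nonword ?scaler0 //; first exact: linear_zero (@tX_linear v w).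
  by rewrite -is_word_catC // block_Mstart.
rewrite (tX_tensor ws).
rewrite /t_word.
case: c hc {ws} => [h|x r /andP[hx hr]]; first by case: (notF h).
rewrite (last_inM_block u hx hr) rot_size_cat.
rewrite /koszul.
apply: signr_scale; rewrite size_cat /= addnS /=.
by rewrite !oddM !oddD /=; case: (odd _); case: (odd _).
Qed.

Lemma iter_tX_linear v w n : linear (iter n (@tX k A M K v w)).
Proof. by elim: n => [|n IH] c x y //=; rewrite IH (@tX_linear v w). Qed.

(** The power of t by the number of letters of M in a segment moves it to the front. *)
Lemma iter_tX v w u c : Mstart u -> Mstart c ->
  iter (count (@inM _ _ M) c) (@tX k A M K v w) (T v w (u ++ c)) = koszul u c *: T v w (c ++ u).
Proof.
have [n] := ubnP (size c); elim: n u c => // n IH u c; rewrite ltnS => cn hu hc.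
have [->|c0] := eqVneq c [::]; first by rewrite /koszul muln0 scale1r cats0.
have [c1 [c2 [e h1 h2]]] := last_block hc c0.
have c2_pos : (0 < size c2)%N by case: (c2) h2.
have c1n : (size c1 < n)%N by move: cn; rewrite e size_cat; lia.
have hu1 : Mstart (u ++ c1) by case: (u) hu.
have h2u : Mstart (c2 ++ u) by case: (c2) h2 => //= x r /andP[].
rewrite e count_cat (block_count h2) addn1 iterSr catA (tX_block _ _ hu1 h2).
rewrite (linear_scale _ _ (@iter_tX_linear v w _)) catA (IH _ _ c1n h2u h1).
rewrite scalerA -!catA /koszul -exprD; apply: signr_scale.
rewrite !size_cat !(oddD, oddM).
by case: (odd (size u)); case: (odd (size c1)); case: (odd (size c2)).
Qed.

Lemma word_Mstart v w s : is_word v w s -> Mstart s.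
Proof. by case: s => //= x r /andP[]. Qed.

Lemma word_count v w s : is_word v w s -> count (@inM _ _ M) s = w.+1.
Proof. by rewrite is_wordE => /and3P[_ _ /eqP]. Qed.

Lemma tX_order v w (x : X M K v w) : iter w.+1 (@tX k A M K v w) x = x.
Proof.
apply: (linear_eq (@iter_tX_linear v w w.+1) (@linear_id k _)) => s hs.
rewrite -{1}(word_count hs) (@iter_tX v w [::] s isT (word_Mstart hs)).
by rewrite /koszul mul0n scale1r cats0.
Qed.

(** * Contractions of a concatenation *)

(** The contraction of u c between the last letter of u and the first letter of c; the
    segments are not empty. *)
Definition junction (op : L -> L -> L) (u c : seq L) : seq L :=
  take (size u).-1 u ++ op (last (letter0 M) u) (head (letter0 M) c) :: behead c.

(** The contraction of u c between the last letter of c and the first letter of u. *)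
Definition cyclic_junction (op : L -> L -> L) (u c : seq L) : seq L :=
  op (last (letter0 M) c) (head (letter0 M) u) :: behead u ++ take (size c).-1 c.

Lemma contract_catl op j (u c : seq L) : (j.+1 < size u)%N ->
  contract op j (u ++ c) = contract op j u ++ c.
Proof.
by case/split_at2 => [s1 [x [y [s2 [-> ->]]]]]; rewrite -catA !contract_mid -catA.
Qed.

Lemma contract_catr op i (u c : seq L) : (i.+1 < size c)%N ->
  contract op (size u + i) (u ++ c) = u ++ contract op i c.
Proof.
case/split_at2 => [s1 [x [y [s2 [-> ->]]]]]; rewrite contract_mid catA -size_cat.
by rewrite contract_mid catA.
Qed.

Lemma contract_junction op p (u c : seq L) : size u = p.+1 -> (0 < size c)%N ->
  contract op p (u ++ c) = junction op u c.
Proof.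
case: c => // y c; case/lastP: u => // u x; rewrite size_rcons => -[<-] _.
by rewrite /junction size_rcons last_rcons /= -cats1 take_size_cat // -catA contract_mid.
Qed.

Lemma contract_cyclic_junction op n (u c : seq L) : (0 < size u)%N -> (0 < size c)%N ->
  size (u ++ c) = n.+1 -> contract op n (u ++ c) = cyclic_junction op u c.
Proof.
case: u => // x u; case/lastP: c => // c y _ _; rewrite -rcons_cat /= size_rcons => -[<-].
by rewrite contract_end /cyclic_junction last_rcons size_rcons /= -cats1 take_size_cat.
Qed.

Notation csum op v w m s := (contraction_sum K op v w m s).

Lemma csum_cat op v w p q (u c : seq L) : size u = p.+1 -> size c = q.+1 ->
  csum op v w (p.+1 + q) (u ++ c)
  = \sum_(j < p) (-1) ^+ j *: T v w (contract op j u ++ c)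
    + (-1) ^+ p *: T v w (junction op u c)
    + \sum_(i < q) (-1) ^+ (p.+1 + i) *: T v w (u ++ contract op i c).
Proof.
move=> up cq; rewrite /contraction_sum big_split_ord big_ord_recr /=.
have cpos : (0 < size c)%N by rewrite cq.
rewrite (contract_junction _ up cpos); apply: (congr2 +%R); [apply: (congr2 +%R)|].
- by apply: eq_bigr => j _; rewrite contract_catl // up ltnS.
- reflexivity.
- by apply: eq_bigr => i _; rewrite -{2}up contract_catr // cq ltnS.
Qed.

Lemma csum_cyclic op v w p q (u c : seq L) : size u = p.+1 -> size c = q.+1 ->
  csum op v w (p.+1 + q).+1 (u ++ c)
  = csum op v w (p.+1 + q) (u ++ c) + (-1) ^+ (p.+1 + q) *: T v w (cyclic_junction op u c).
Proof.
move=> up cq; rewrite {1}/contraction_sum big_ord_recr /= contract_cyclic_junction ?up ?cq //.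
by rewrite size_cat up cq addnS.
Qed.

Lemma Mstart_head (s : seq L) : (0 < size s)%N -> Mstart s = inM (head (inl 0 : L) s).
Proof. by case: s. Qed.

Lemma Mstart_contract op j (s : seq L) : contraction_op op -> (j.+1 < size s)%N ->
  Mstart s -> Mstart (contract op j s).
Proof.
move=> hop js; have js' := ltnW js; have s1 : (1 < size s)%N by apply: leq_ltn_trans js.
rewrite !Mstart_head ?size_contract ?(ltnW s1) //; last by case: (s) s1 => // a [].
exact: head_contract.
Qed.

(** Two letters of A have a product in A, or zero. *)
Definition typed_op (op : L -> L -> L) : Prop :=
  (forall x y, inA x -> inA y -> inA (op x y) || (op x y == letter0 M)).

Lemma block_contract op i (c : seq L) : contraction_op op -> typed_op op ->
  block c -> (i.+1 < size c)%N ->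
  block (contract op i c) || (letter0 M \in contract op i c).
Proof.
move=> hop top hc ic; have [s1 [x [y [s2 [e ->]]]]] := split_at2 ic; subst c.
rewrite contract_mid; case: s1 hc {ic} => [|z s1] /=.
  by case/and3P => hx _ ->; rewrite (cop_inMl hop).
rewrite !all_cat /= => /and5P[-> -> hx hy ->] /=; rewrite in_cons mem_cat in_cons.
by case/orP: (top _ _ hx hy) => [->|/eqP->]; rewrite ?eqxx ?orbT.
Qed.

Lemma tX_zero v w : tX 0 = 0 :> X M K v w.
Proof. exact: linear_zero (@tX_linear v w). Qed.

Lemma tX_block_or_zero v w u c : Mstart u -> block c || (letter0 M \in c) ->
  tX (T v w (u ++ c)) = koszul u c *: T v w (c ++ u).
Proof.
move=> hu /orP[hc|hc]; first exact: tX_block.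
by rewrite !tensor_zero ?tX_zero ?scaler0 // mem_cat hc ?orbT.
Qed.

(* Compares the parities of two expressions in the lengths of words. *)
Ltac parity := rewrite ?size_cat ?(oddD, oddM) /= ?(oddD, oddM) /=;
  repeat match goal with |- context [odd ?n] => case: (odd n) end; try reflexivity.

(** The cyclic operator permutes the contractions inside the two segments, and takes
    the contraction at their junction to the cyclic one; only the junction of the
    rotated word is not reached. *)
Lemma tX_csum op v w p q (u c : seq L) : contraction_op op -> typed_op op ->
  Mstart u -> block c -> size u = p.+1 -> size c = q.+1 ->
  tX (csum op v w (p.+1 + q) (u ++ c))
    + (-1) ^+ (p.+1 * q.+1 + q) *: T v w (junction op c u)
  = koszul u c *: csum op v w (q.+1 + p).+1 (c ++ u).
Proof.
move=> hop top hu hc up cq.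
have tl := @tX_linear v w.
have tD (x y : X M K v w) : tX (x + y) = tX x + tX y.
  by have := tl 1 x y; rewrite !scale1r.
have e1 : tX (\sum_(j < p) (-1) ^+ j *: T v w (contract op j u ++ c))
    = koszul u c *: \sum_(j < p) (-1) ^+ (q.+1 + j) *: T v w (c ++ contract op j u).
  rewrite (linear_lcomb_sum _ _ tl) scaler_sumr; apply: eq_bigr => j _.
  have ju : (j.+1 < size u)%N by rewrite up ltnS.
  have sj : size (contract op j u) = p by rewrite
    (size_contract op (leq_ltn_trans _ ju) (ltnW ju)) // up.
  rewrite (tX_block _ _ (Mstart_contract hop ju hu) hc) /koszul up cq sj !scalerA -!exprD.
  by apply: signr_scale; parity.
have e2 : tX (\sum_(i < q) (-1) ^+ (p.+1 + i) *: T v w (u ++ contract op i c))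
    = koszul u c *: \sum_(i < q) (-1) ^+ i *: T v w (contract op i c ++ u).
  rewrite (linear_lcomb_sum _ _ tl) scaler_sumr; apply: eq_bigr => i _.
  have ic : (i.+1 < size c)%N by rewrite cq ltnS.
  have si : size (contract op i c) = q by rewrite
    (size_contract op (leq_ltn_trans _ ic) (ltnW ic)) // cq.
  rewrite (tX_block_or_zero _ _ hu (block_contract hop top hc ic)) /koszul up cq si !scalerA
    -!exprD.
  by apply: signr_scale; parity.
have e3 : tX ((-1) ^+ p *: T v w (junction op u c))
    = koszul u c *: ((-1) ^+ (q.+1 + p) *: T v w (cyclic_junction op c u)).
  have s1 : size (take (size u).-1 u) = p by rewrite size_takel up.
  have s2 x : size (x :: behead c) = q.+1 by rewrite /= size_behead cq.
  have h1 : Mstart (take (size u).-1 u) by case: (u) hu => [|x [|y r]].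
  have h2 : block (op (last (letter0 M) u) (head (letter0 M) c) :: behead c).
    by case: (c) hc => //= x r /andP[hx ->]; rewrite (cop_inMr hop).
  have ej : cyclic_junction op c u
      = (op (last (letter0 M) u) (head (letter0 M) c) :: behead c) ++ take (size u).-1 u by [].
  rewrite ej /junction (linear_scale _ _ tl) (tX_block _ _ h1 h2) /koszul s1 s2 up cq !scalerA
    -!exprD.
  by apply: signr_scale; parity.
have e4 : (-1) ^+ (p.+1 * q.+1 + q) *: T v w (junction op c u)
    = koszul u c *: ((-1) ^+ q *: T v w (junction op c u)).
  by rewrite /koszul up cq [RHS]scalerA -exprD; reflexivity.
rewrite (csum_cyclic _ _ _ cq up) (csum_cat _ _ _ up cq) (csum_cat _ _ _ cq up).
rewrite !tD e1 e2 e3 e4 -!scalerDr; apply: (congr1 (fun x => koszul u c *: x)).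
exact: addr_pairs.
Qed.

(** * The cyclic operator and the differentials *)

Lemma mul_typed : typed_op mul. Proof. by case=> [a|m] [b|n]. Qed.
Lemma tri_typed : typed_op trl. Proof. by case=> [a|m] [b|n] //= _ _; rewrite eqxx. Qed.

Lemma tX0 v (x : X M K v 0) : tX x = x. Proof. exact: (tX_order x). Qed.

Lemma word_split v w s : is_word v w.+1 s -> exists p q u c,
  [/\ s = u ++ c, Mstart u, block c, size u = p.+1 & size c = q.+1].
Proof.
move=> hs; have s0 : s != [::] by case: (s) hs.
have [u [c [e hu hc]]] := last_block (word_Mstart hs) s0.
have u0 : (0 < size u)%N.
  rewrite lt0n; apply/negP => /nilP eu; have := word_count hs.
  by rewrite e eu /= block_count.
have c0 : (0 < size c)%N by case: (c) hc.
by exists (size u).-1, (size c).-1, u, c; rewrite !prednK.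
Qed.

Lemma block_last (c : seq L) q : block c -> size c = q.+2 -> inA (last (letter0 M) c).
Proof.
case/lastP: c => // c y; rewrite last_rcons size_rcons.
by case: c => //= x r /andP[_]; rewrite all_rcons => /andP[].
Qed.

Lemma block1 (c : seq L) : block c -> size c = 1%N -> exists2 m, c = [:: m] & inM m.
Proof. by case: c => [|x [|y r]] //= /andP[hx _] _; exists x. Qed.

Lemma Mstart_cons (u : seq L) p : Mstart u -> size u = p.+1 ->
  exists2 h, u = h :: behead u & inM h.
Proof. by case: u => //= h r hh _; exists h. Qed.

(** For [mulL], the cyclic contraction of u c is moved by t to the junction of c u, which
    is the term missing in [tX_csum]. If c is a single letter, both vanish. *)
Lemma tX_mul_cyclic v w p q (u c : seq L) :
  Mstart u -> block c -> size u = p.+1 -> size c = q.+1 ->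
  tX (T v w (cyclic_junction mul u c)) = (-1) ^+ (p.+1 * q) *: T v w (junction mul c u).
Proof.
move=> hu hc up cq; have [h eu hh] := Mstart_cons hu up.
case: q cq => [|q] cq.
  have [m ec hm] := block1 hc cq.
  have e0 : mul m h = letter0 M by case: (m) (h) hm hh => [a|m'] // [b|n].
  rewrite /cyclic_junction /junction ec eu /= e0 !tensor_zero ?tX_zero ?scaler0 //.
  - by rewrite in_cons eqxx.
  - by rewrite in_cons eqxx.
have h1 : Mstart (mul (last (letter0 M) c) h :: behead u).
  by rewrite /=; case: (last _ _) (h) hh => [a|n] [].
have h2 : block (take (size c).-1 c).
  rewrite cq; case: (c) hc => //= x r /andP[-> hr] /=; apply/allP => y /mem_take; exact: (allP hr).
have s2 : size (take (size c).-1 c) = q.+1 by rewrite size_takel cq.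
have s1 : size (mul (last (letter0 M) c) h :: behead u) = p.+1 by rewrite /= size_behead up.
have ej : cyclic_junction mul u c
    = (mul (last (letter0 M) c) h :: behead u) ++ take (size c).-1 c.
  by rewrite /cyclic_junction {1}eu.
have ej' : junction mul c u
    = take (size c).-1 c ++ (mul (last (letter0 M) c) h :: behead u).
  by rewrite /junction {1}eu.
by rewrite ej ej' (tX_block _ _ h1 h2) /koszul s1 s2.
Qed.

(** For [triL], both contractions vanish unless c is a single letter, and then they are
    equal. *)
Lemma tri_junction v w p q (u c : seq L) :
  Mstart u -> block c -> size u = p.+1 -> size c = q.+1 ->
  (-1) ^+ (p.+1 * q.+1 + q) *: T v w (junction trl c u)
  = (-1) ^+ (p.+1 + q) *: T v w (cyclic_junction trl u c).
Proof.
move=> hu hc up; case: q => [|q] cq.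
  have [m ec hm] := block1 hc cq.
  by rewrite /junction /cyclic_junction ec /= cats0 muln1.
have e0 : trl (last (letter0 M) c) (head (letter0 M) u) = letter0 M.
  by case: (last _ _) (block_last hc cq).
rewrite /junction /cyclic_junction e0 !tensor_zero ?scaler0 //.
- by rewrite in_cons eqxx.
- by rewrite mem_cat in_cons eqxx orbT.
Qed.

Lemma tri_first_junction v w p q (u c : seq L) :
  Mstart u -> block c -> size u = p.+1 -> size c = q.+1 ->
  koszul u c *: T v w (contract trl 0 (c ++ u))
  = (-1) ^+ (p.+1 + q) *: T v w (cyclic_junction trl u c).
Proof.
move=> hu hc up; have [h eu hh] := Mstart_cons hu up; case: q => [|q] cq.
  have [m ec hm] := block1 hc cq.
  rewrite /koszul up cq /cyclic_junction ec eu /= contract0 cats0.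
  by rewrite addn0 muln1.
have e0 : trl (last (letter0 M) c) (head (letter0 M) u) = letter0 M.
  by case: (last _ _) (block_last hc cq).
have z1 : letter0 M \in contract trl 0 (c ++ u).
  case: (c) hc cq => [|x [|y r]] //= /and3P[_ hy _] _; rewrite contract0 in_cons.
  by case: (x) (y) hy => [a|m] [b|n] //; rewrite eqxx.
by rewrite /cyclic_junction e0 !tensor_zero ?scaler0 // in_cons eqxx.
Qed.

Lemma bX_tX v w (x : X M K v.+1 w) : bX (tX x) = tX (bX x).
Proof.
case: w x => [|w] x; first by rewrite !tX0.
apply: (linear_eq (linear_comp (@bX_linear _ _ M K v w.+1) (@tX_linear v.+1 w.+1))
  (linear_comp (@tX_linear v w.+1) (@bX_linear _ _ M K v w.+1))) => s hs.
have [p [q [u [c [e hu hc up cq]]]]] := word_split hs; subst s.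
have hs' : is_word v.+1 w.+1 (c ++ u) by rewrite -is_word_catC // block_Mstart.
have sz1 : (1 < size (u ++ c))%N by rewrite size_cat up cq addnS.
have sz2 : (1 < size (c ++ u))%N by rewrite size_cat up cq addnS.
have wz1 : is_word v.+1 w.+1 (u ++ c) || (letter0 M \in u ++ c) by rewrite hs.
have wz2 : is_word v.+1 w.+1 (c ++ u) || (letter0 M \in c ++ u) by rewrite hs'.
rewrite (tX_block _ _ hu hc) (linear_scale _ _ (@bX_linear _ _ M K v w.+1)).
rewrite (bX_tensor K wz1 sz1) (bX_tensor K wz2 sz2).
have s1 : size (u ++ c) = (p.+1 + q).+1 by rewrite size_cat up cq addnS.
have s2 : size (c ++ u) = (q.+1 + p).+1 by rewrite size_cat up cq addnS.
have tl := @tX_linear v w.+1.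
rewrite s1 s2 -(tX_csum _ _ (@mulL_contraction _ _ M) mul_typed hu hc up cq).
rewrite (csum_cyclic _ _ _ up cq) [X in _ = tX X]addrC.
rewrite tl (tX_mul_cyclic _ _ hu hc up cq) scalerA -exprD addrC.
apply: (congr2 +%R); first reflexivity.
by apply: signr_scale; parity.
Qed.

Lemma dX_eq v w (x : X M K v w.+1) :
  dX tri x = (dX' tri x : X M K v w) + e0X tri (tX x) :> X M K v w.
Proof.
apply: (linear_eq (@dX_linear _ _ M tri K htri v w) (linear_add (@dX'_linear _ _ M tri K htri v w)
  (linear_comp (@e0X_linear _ _ M tri K htri v w) (@tX_linear v w.+1)))) => s hs.
have [p [q [u [c [e hu hc up cq]]]]] := word_split hs; subst s.
have hs' : is_word v w.+1 (c ++ u) by rewrite -is_word_catC // block_Mstart.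
have sz1 : (1 < size (u ++ c))%N by rewrite size_cat up cq addnS.
have sz2 : (1 < size (c ++ u))%N by rewrite size_cat up cq addnS.
have wz1 : is_word v w.+1 (u ++ c) || (letter0 M \in u ++ c) by rewrite hs.
have wz2 : is_word v w.+1 (c ++ u) || (letter0 M \in c ++ u) by rewrite hs'.
have s1 : size (u ++ c) = (p.+1 + q).+1 by rewrite size_cat up cq addnS.
rewrite (tX_block _ _ hu hc) (linear_scale _ _ (@e0X_linear _ _ M tri K htri v w)).
rewrite (dX_tensor K htri wz1 sz1) (dX'_tensor K htri wz1 sz1) (e0X_tensor K htri wz2 sz2) s1.
by rewrite (csum_cyclic _ _ _ up cq) (tri_first_junction _ _ hu hc up cq).
Qed.

Lemma dX_tX v w (x : X M K v w.+1) :
  dX tri (tX x) = tX (dX' tri x : X M K v w) + e0X tri (tX x) :> X M K v w.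
Proof.
apply: (linear_eq (linear_comp (@dX_linear _ _ M tri K htri v w) (@tX_linear v w.+1))
  (linear_add (linear_comp (@tX_linear v w) (@dX'_linear _ _ M tri K htri v w))
  (linear_comp (@e0X_linear _ _ M tri K htri v w) (@tX_linear v w.+1)))) => s hs.
have [p [q [u [c [e hu hc up cq]]]]] := word_split hs; subst s.
have hs' : is_word v w.+1 (c ++ u) by rewrite -is_word_catC // block_Mstart.
have sz1 : (1 < size (u ++ c))%N by rewrite size_cat up cq addnS.
have sz2 : (1 < size (c ++ u))%N by rewrite size_cat up cq addnS.
have wz1 : is_word v w.+1 (u ++ c) || (letter0 M \in u ++ c) by rewrite hs.
have wz2 : is_word v w.+1 (c ++ u) || (letter0 M \in c ++ u) by rewrite hs'.
have s1 : size (u ++ c) = (p.+1 + q).+1 by rewrite size_cat up cq addnS.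
have s2 : size (c ++ u) = (q.+1 + p).+1 by rewrite size_cat up cq addnS.
rewrite (tX_block _ _ hu hc) (linear_scale _ _ (@dX_linear _ _ M tri K htri v w)).
rewrite (linear_scale _ _ (@e0X_linear _ _ M tri K htri v w)).
rewrite (dX_tensor K htri wz2 sz2) (dX'_tensor K htri wz1 sz1) (e0X_tensor K htri wz2 sz2) s1 s2.
rewrite -(tX_csum _ _ (triL_contraction htri) tri_typed hu hc up cq).
by rewrite (tri_junction _ _ hu hc up cq) (tri_first_junction _ _ hu hc up cq).
Qed.

Lemma NX_linear v w : linear (@NX k A M K v w).
Proof.
exact: (norm_linear (linear_bundle (@tX_linear v w))).
Qed.

Lemma NX_tX v w (x : X M K v w) : NX (tX x) = NX x.
Proof.
exact: (norm_t (t := linear_bundle (@tX_linear v w)) (@tX_order v w)).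
Qed.

Lemma NX_iter v w n (x : X M K v w) : NX (iter n (@tX k A M K v w) x) = NX x.
Proof. by elim: n => //= n IH; rewrite NX_tX. Qed.

(** Counting the letters of M of a word from the right. *)
Lemma sum_over_inM (V : nmodType) (f : nat -> V) (s : seq L) :
  \sum_(j < size s) (if inM (nth (letter0 M) s j) then f (count (@inM _ _ M) (drop j s)) else 0)
  = \sum_(i < count (@inM _ _ M) s) f i.+1.
Proof.
elim: s => [|x s IH]; first by rewrite !big_ord0.
rewrite big_ord_recl /=; under eq_bigr do rewrite /=.
rewrite IH; case: (inM x); last by rewrite add0r.
by rewrite add1n big_ord_recr /= addrC.
Qed.

(** Up to rotation, a contraction by [triL] at a letter of M is the contraction e of the
    word rotated to begin with that letter; at a letter of A it vanishes. *)
Lemma NX_contract v w (s : seq L) j : is_word v w.+1 s -> (1 < size s)%N -> (j < size s)%N ->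
  (-1) ^+ j *: NX (T v w (contract trl j s))
  = if inM (nth (letter0 M) s j) then
      NX (e0X tri (iter (count (@inM _ _ M) (drop j s)) (@tX k A M K v w.+1) (T v w.+1 s)))
    else 0.
Proof.
move=> hs s2 js; have ecut : s = take j s ++ drop j s by rewrite cat_take_drop.
have ej : size (take j s) = j by rewrite size_takel // ltnW.
have hu : Mstart (take j s) by have := word_Mstart hs; case: (s) (j) => [|x r] [|i].
have NX0 : NX 0 = 0 :> X M K v w by exact: linear_zero (@NX_linear v w).
case ec : (drop j s) => [|x c].
  by have := size_drop j s; rewrite ec /= => /esym/eqP; rewrite subn_eq0 leqNgt js.
have -> : nth (letter0 M) s j = x by rewrite -[j in nth _ _ j]addn0 -nth_drop ec.
rewrite ec in ecut; move: (take j s) ecut ej hu => u ecut ej hu.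
have hwz : is_word v w.+1 (u ++ x :: c) by rewrite -ecut.
case: ifP => hx; last first.
  rewrite tensor_zero ?NX0 ?scaler0 //; case: x hx ecut {ec hwz} => // a _ ecut.
  rewrite ecut -ej; case: (c) ecut => [|y c1] ecut; last first.
    by rewrite contract_mid mem_cat in_cons; case: (y) => ?; rewrite eqxx orbT.
  have u0 : (0 < size u)%N by move: s2; rewrite ecut size_cat /= addn1 ltnS.
  rewrite contract_cyclic_junction ?size_cat ?addn1 // in_cons.
  by case: (head _ _) => ?; rewrite /= eqxx.
have hc : Mstart (x :: c) by [].
have hwz' : is_word v w.+1 (x :: c ++ u) by rewrite -cat_cons -is_word_catC.
have sz' : (1 < size (x :: c ++ u))%N.
  by move: s2; rewrite ecut size_cat /= size_cat /= addnS addnC.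
have wz' : is_word v w.+1 (x :: c ++ u) || (letter0 M \in x :: c ++ u) by rewrite hwz'.
rewrite ecut (@iter_tX v w.+1 _ _ hu hc) (linear_scale _ _ (@e0X_linear _ _ M tri K htri v w)).
rewrite (linear_scale _ _ (@NX_linear v w)) (e0X_tensor K htri wz' sz').
case: c ecut {ec hwz hwz' hc} sz' wz' => [|y c] ecut sz' wz'.
  have u0 : (0 < size u)%N by move: s2; rewrite ecut size_cat /= addn1 ltnS.
  have ecyc : contract trl j (u ++ [:: x]) = contract trl 0 (x :: u).
    have us : size (u ++ [:: x]) = j.+1 by rewrite size_cat ej addn1.
    rewrite (contract_cyclic_junction _ u0 _ us) //.
    by case: (u) u0 => // h r _; rewrite contract0 /cyclic_junction /= cats0.
  rewrite ecyc cat0s /koszul ej.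
  by apply: signr_scale; rewrite muln1.
have emid : contract trl j (u ++ x :: y :: c) = u ++ trl x y :: c.
  by rewrite -ej contract_mid.
rewrite emid cat_cons contract0.
have hz : Mstart (trl x y :: c) by case: (x) (y) hx => [a|m] // [b|n].
have := NX_iter (count (@inM _ _ M) (trl x y :: c)) (T v w (u ++ trl x y :: c)).
rewrite (@iter_tX v w _ _ hu hz) (linear_scale _ _ (@NX_linear v w)) => <-.
by rewrite scalerA /koszul -exprD ej; apply: signr_scale; rewrite /=; parity.
Qed.

Lemma NX_dX_e0X v w (x : X M K v w.+1) :
  NX (dX tri x : X M K v w) = NX (e0X tri (NX x)).
Proof.
have Nl := @NX_linear v w; have el := @e0X_linear _ _ M tri K htri v w.
apply: (linear_eq (linear_comp Nl (@dX_linear _ _ M tri K htri v w))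
  (linear_comp Nl (linear_comp el (@NX_linear v w.+1)))) => s hs.
have sz : (1 < size s)%N by rewrite (size_word hs) !addnS.
have wz : is_word v w.+1 s || (letter0 M \in s) by rewrite hs.
rewrite (dX_tensor K htri wz sz) (linear_lcomb_sum _ _ Nl).
under eq_bigr => j _ do rewrite (NX_contract hs sz (ltn_ord j)).
rewrite (sum_over_inM (fun n => NX (e0X tri (iter n (@tX k A M K v w.+1) (T v w.+1 s))))).
rewrite (word_count hs) -(NX_tX (T v w.+1 s)) [NX (tX (T v w.+1 s))]/NX.
rewrite [RHS](linear_big _ (linear_comp Nl el)); apply: eq_bigr => l _.
by rewrite -(iterSr l (@tX k A M K v w.+1) (T v w.+1 s)).
Qed.

End Cyclic.

(** * Transport of double mixed complexes *)

(** If f is an injective morphism from Y to a double mixed complex Z, with a linear left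
    inverse g, then Y is a double mixed complex; if g is also a right inverse on Z, then f
    is an isomorphism. The whole carrier of Y is taken as its submodule. *)
Section Transport.
Variables (k : comNzRingType) (Y Z : dmc_data k).
Variables (f : forall v w, car Y v w -> car Z v w) (g : forall v w, car Z v w -> car Y v w).
Hypothesis hZ : is_double_mixed_complex Z.
Hypothesis subY : forall v w x, @sub k Y v w x.
Hypothesis hf : is_dmc_morphism (@f).
Hypothesis g_linear : forall v w, linear_on (@sub k Z v w) (@sub k Y v w) (@g v w).
Hypothesis gf : forall v w (x : car Y v w), g (f x) = x.

Fact sub_f v w (x : car Y v w) : @sub k Z v w (f x).
Proof. by case: (@dmc_mor_linear _ _ _ _ hf v w) => h _; apply: h. Qed.

Fact g0 v w : @g v w 0 = 0.
Proof.
have [z0 _] := @dmc_submodule _ _ hZ v w; have [_ lg] := @g_linear v w.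
by have := lg (-1) 0 0 z0 z0; rewrite scaler0 addr0 scaleN1r addNr.
Qed.

Fact fD v w (x y : car Y v w) : f (x + y) = f x + f y.
Proof.
by have [_ h] := @dmc_mor_linear _ _ _ _ hf v w; have := h 1 x y; rewrite !scale1r => ->.
Qed.

Lemma transport_linear v w v' w' (h : car Y v w -> car Y v' w') (h' : car Z v w -> car Z v' w') :
  linear_on (@sub k Z v w) (@sub k Z v' w') h' ->
  (forall x, f (h x) = h' (f x)) ->
  linear_on (@sub k Y v w) (@sub k Y v' w') h.
Proof.
move=> [sh lh] fh; split=> // c x y _ _; have [_ lf] := @dmc_mor_linear _ _ _ _ hf v w.
have [_ lg] := @g_linear v' w'.
rewrite -[LHS]gf fh lf // lh; try exact: sub_f.
by rewrite lg -?fh ?gf //; exact: sub_f.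
Qed.

Lemma transport_dmc : is_double_mixed_complex Y.
Proof.
have [fl fb fbeta fB] := hf; case: hZ => zs bl betal Bl bb betabeta BB betab betaB betaB0 bB.
split=> [v w|v w|v w|v w|v w x _|v w x _|v w x _|v w x _|v w x _|v x _|v w x _].
- by split.
- by apply: transport_linear (bl v w) _ => x; exact: fb.
- by apply: transport_linear (betal v w) _ => x; exact: fbeta.
- by apply: transport_linear (Bl v w) _ => x; exact: fB.
- by rewrite -[LHS]gf !fb // bb ?g0 //; exact: sub_f.
- by rewrite -[LHS]gf !fbeta // betabeta ?g0 //; exact: sub_f.
- by rewrite -[LHS]gf !fB // BB ?g0 //; exact: sub_f.
- by rewrite -[LHS]gf fD fbeta // !fb // fbeta // betab ?g0 //; exact: sub_f.
- by rewrite -[LHS]gf fD fbeta // !fB // fbeta // betaB ?g0 //; exact: sub_f.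
- by rewrite -[LHS]gf fbeta // fB // betaB0 ?g0 //; exact: sub_f.
- by rewrite -[LHS]gf fD fb // !fB // fb // bB ?g0 //; exact: sub_f.
Qed.

Lemma transport_iso : (forall v w (x : car Z v w), @sub k Z v w x -> f (g x) = x) ->
  is_dmc_isomorphism f.
Proof.
move=> fg; split=> //; exists (@g); split=> //; have [fl fb fbeta fB] := hf.
split=> [v w|v w x sx|v w x sx|v w x sx]; first exact: g_linear.
- by rewrite -{1}[x]fg // -fb // gf.
- by rewrite -{1}[x]fg // -fbeta // gf.
- by rewrite -{1}[x]fg // -fB // gf.
Qed.

End Transport.

(** * Harmonic pairs over operators of finite order *)

(** Bigraded modules X with maps t, b, d and d' satisfying the relations listed below,
    and models Xb of the coinvariants: p and n stand for the maps from X to Xb and back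
    with p n = id and n p = pi, and bb and db for the maps induced by b and d. The maps d,
    d' and db take values in degree w - 1, so in a zero module when w = 0. *)
Section Harmonic.
Variables (k : comNzRingType) (iota : {rmorphism rat -> k}).
Variables (X Xb : nat -> nat -> lmodType k).
Variables (t : forall v w, {linear X v w -> X v w}) (b : forall v w, {linear X v.+1 w -> X v w}).
Variables (d d' : forall v w, X v w -> shift (X v) w).
Variables (p : forall v w, {linear X v w -> Xb v w}) (n : forall v w, {linear Xb v w -> X v w}).
Variables (bb : forall v w, Xb v.+1 w -> Xb v w) (db : forall v w, Xb v w -> shift (Xb v) w).

(** The maps d, d' and db in positive degree, as maps between consecutive terms. *)
Definition d1 v w : X v w.+1 -> X v w := @d v w.+1.
Definition d1' v w : X v w.+1 -> X v w := @d' v w.+1.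
Definition db1 v w : Xb v w.+1 -> Xb v w := @db v w.+1.

Hypothesis d1_linear : forall v w, linear (@d1 v w).
Hypothesis d1'_linear : forall v w, linear (@d1' v w).
HB.instance Definition _ v w := GRing.isLinear.Build k _ _ *:%R (@d1 v w) (@d1_linear v w).
HB.instance Definition _ v w := GRing.isLinear.Build k _ _ *:%R (@d1' v w) (@d1'_linear v w).

Notation N v w := (norm (t v w) w).
Notation pi v w := (invp iota (t v w) w).
Notation sg v w := (sig iota (t v w) w).
Notation q := (qinv iota).

Hypothesis t_order : forall v w x, iter w.+1 (t v w) x = x.
Hypothesis bt : forall v w x, b v w (t v.+1 w x) = t v w (b v w x).
Hypothesis b_b : forall v w x, b v w (b v.+1 w x) = 0.
Hypothesis d_d : forall v w (x : X v w.+2), d1 (d1 x) = 0.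
Hypothesis d'_d' : forall v w (x : X v w.+2), d1' (d1' x) = 0.
Hypothesis b_d : forall v w (x : X v.+1 w.+1), b v w (d1 x) + d1 (b v w.+1 x) = 0.
Hypothesis b_d' : forall v w (x : X v.+1 w.+1), b v w (d1' x) + d1' (b v w.+1 x) = 0.
Hypothesis d_t : forall v w (x : X v w.+1),
  d1 x - d1 (t v w.+1 x) = d1' x - t v w (d1' x).
Hypothesis d'_norm : forall v w (x : X v w.+1), d1' (N v w.+1 x) = N v w (d1 x).
Hypothesis pn : forall v w z, p v w (n v w z) = z.
Hypothesis np : forall v w x, n v w (p v w x) = pi v w x.
Hypothesis n_bb : forall v w z, n v w (bb z) = b v w (n v.+1 w z).
Hypothesis n_db : forall v w (z : Xb v w.+1), n v w (db1 z) = d1' (n v w.+1 z).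

Lemma t_n v w z : t v w (n v w z) = n v w z.
Proof. by rewrite -{1}[z]pn np t_invp // -np pn. Qed.

Lemma d'_inv v w (x : X v w.+1) : t v w.+1 x = x -> t v w (d1' x) = d1' x.
Proof. by move=> tx; have := d_t x; rewrite tx subrr => /esym/subr0_eq/esym. Qed.

Lemma pi_d v w (x : X v w.+1) : t v w.+1 x = x ->
  pi v w (d1 x) = (w.+2%:R * q w) *: d1' x.
Proof.
by move=> tx; rewrite /invp -d'_norm norm_invariant // linearZ scalerA mulrC.
Qed.

(** The map Upsilon in positive degree, defined on all of X. *)
Definition upsilon1 v w (x : X v w.+1) : X v w :=
  - sg v w (d1 x) + n v w (p v w (sg v w (d1 x))).

Fact upsilon1_linear v w : linear (@upsilon1 v w).
Proof.
by move=> c x y; rewrite /upsilon1 !linearP /= scalerDr addrACA.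
Qed.
HB.instance Definition _ v w := GRing.isLinear.Build k _ _ *:%R (@upsilon1 v w)
  (@upsilon1_linear v w).

Lemma p_upsilon1 v w (x : X v w.+1) : p v w (upsilon1 x) = 0.
Proof. by rewrite /upsilon1 linearD linearN /= pn addNr. Qed.

Lemma upsilon1_sub_t v w (x : X v w.+1) : upsilon1 x - t v w (upsilon1 x) = pi v w (d1 x) - d1 x.
Proof.
rewrite /upsilon1 linearD linearN /= t_n opprD opprK addrACA subrr addr0.
by rewrite -[RHS]opprB -(sig_sub_t iota (t v w) w) opprB addrC.
Qed.

Lemma b_pi v w x : b v w (pi v.+1 w x) = pi v w (b v w x).
Proof.
rewrite /invp linearZ /norm linear_sum; congr (_ *: _); apply: eq_bigr => l _ /=.
by elim: (nat_of_ord l) => //= i IH; rewrite bt IH.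
Qed.

Lemma b_sig v w x : b v w (sg v.+1 w x) = sg v w (b v w x).
Proof.
rewrite /sig linear_sum; apply: eq_bigr => l _ /=; rewrite linearZ; congr (_ *: _).
by elim: (nat_of_ord l) => //= i IH; rewrite bt IH.
Qed.

Lemma b_upsilon1 v w (x : X v.+1 w.+1) : b v w (upsilon1 x) = - upsilon1 (b v w.+1 x).
Proof.
have bd : b v w (d1 x) = - d1 (b v w.+1 x) by apply/eqP; rewrite -addr_eq0 b_d.
by rewrite /upsilon1 !np linearD linearN /= b_pi b_sig bd !linearN /= opprD.
Qed.

(** The second component of the compatibility of psi with d; the last term comes from xi. *)
Lemma upsilon1_key v w (u : X v w.+2) : t v w.+2 u = u ->
  - d1' (upsilon1 u) = upsilon1 (pi v w.+1 (d1 u)) + pi v w (d1' (sg v w.+1 (d1 u))).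
Proof.
move=> tu; set s := sg v w.+1 (d1 u); set z := d1' s + sg v w (d1 (pi v w.+1 (d1 u))).
have norm_pi v' w' x : pi v' w' x = q w' *: N v' w' x by [].
have d_pi_d : pi v w (d1 (pi v w.+1 (d1 u))) = 0.
  rewrite pi_d ?t_invp // norm_pi linearZ /= d'_norm d_d linear0 !scaler0 //.
have d'_pi_s : d1' (pi v w.+1 s) = 0.
  have [c ->] := @invp_sig _ iota _ _ _ (@t_order v w.+1) (d1 u).
  by rewrite norm_pi !linearZ /= d'_norm d_d linear0 !scaler0.
(* The two summands of z have opposite images under id - t, since pi d pi d u = 0. *)
have tz : t v w z = z.
  apply/esym/subr0_eq; rewrite /z linearD opprD addrACA -d_t -linearB /=.
  by rewrite !sig_sub_t d_pi_d subr0 linearB /= d_d sub0r addNr.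
have := @invp_invariant _ iota _ (t v w) w _ tz; rewrite /z linearD /= => ez.
have -> : d1' (upsilon1 u) = - d1' s by rewrite /upsilon1 np linearD linearN /= d'_pi_s addr0.
set y := sg v w (d1 (pi v w.+1 (d1 u))) in ez *.
have -> : upsilon1 (pi v w.+1 (d1 u)) = - y + pi v w y by rewrite /upsilon1 np.
by rewrite opprK -addrA [X in _ = _ + X]addrC ez addrC addrK.
Qed.

(** * The two complexes *)

(** The pairs that form the ambient module of the harmonic part, and the maps on them. *)
Definition HX v w : lmodType k := (X v w * shift (X v) w)%type.

(** The pairs of coinvariants. *)
Definition CX v w : lmodType k := (Xb v w * shift (Xb v) w)%type.

Definition hb v w (z : HX v.+1 w) : HX v w :=
  (b v w z.1, - shift_map (fun w => b v w : X v.+1 w -> X v w) z.2).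

Definition hd v w (z : HX v w.+1) : HX v w :=
  (d1 z.1 + (z.2 - t v w z.2), - d' (z.2 : X v w)).

Definition hB v w (z : HX v w) : HX v w.+1 := (0, N v w z.1).

(** The Karoubi operator. *)
Definition hkappa v w (z : HX v w) : HX v w :=
  (t v w z.1, shift_map (fun w => t v w : X v w -> X v w) z.2 + d' z.1 - d z.1).

(** The kernel of (kappa - id)^2. *)
Definition is_harmonic v w (z : HX v w) : Prop :=
  let km1 (u : HX v w) := hkappa u - u in km1 (km1 z) = 0.

Definition harmonic_dmc : dmc_data k := DmcData is_harmonic hb hd hB.

(** The map xi on coinvariants. *)
Definition cxibar v w : Xb v w.+1 -> shift (Xb v) w :=
  match w return Xb v w.+1 -> shift (Xb v) w with
  | 0 => fun _ => 0
  | w'.+1 => fun x =>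
      q w'.+2 *: p v w' (d1' (sg v w'.+1 (d1 (n v w'.+2 x))))
  end.

(** The map Upsilon, which is 0 in degree 0. *)
Definition upsilon v w : X v w -> shift (X v) w :=
  match w return X v w -> shift (X v) w with
  | 0 => fun _ => 0
  | w'.+1 => @upsilon1 v w'
  end.

(** The maps on pairs of coinvariants. *)
Definition cb v w (z : CX v.+1 w) : CX v w := (bb z.1, - shift_map (@bb v) z.2).

Definition cd v w (z : CX v w.+1) : CX v w := (db1 z.1, - db (z.2 : Xb v w)).

Definition cxi v w (z : CX v w.+1) : CX v w := (0, cxibar z.1).

Definition cB v w (z : CX v w) : CX v w.+1 := (0, z.1).

Definition coinvariant_dmc : dmc_data k :=
  @DmcData k CX (fun _ _ _ => True) cb (fun v w z => cd z + cxi z) cB.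

(** The map Psi of the theorem. *)
Definition psi v w (z : CX v w) : HX v w :=
  q w *: ((n v w z.1, upsilon (n v w z.1)) : HX v w)
  + ((0, shift_map (fun w => n v w : Xb v w -> X v w) z.2) : HX v w).

(** The inverse of psi. *)
Definition psi_inv v w (z : HX v w) : CX v w :=
  (w.+1%:R *: p v w z.1, shift_map (fun w => p v w : X v w -> Xb v w) z.2).

Lemma psiE v w (z : CX v w) :
  psi z = (q w *: n v w z.1, q w *: upsilon (n v w z.1)
           + shift_map (fun w => n v w : Xb v w -> X v w) z.2).
Proof.
rewrite -[LHS]/(q w *: n v w z.1 + 0, q w *: upsilon (n v w z.1)
           + shift_map (fun w => n v w : Xb v w -> X v w) z.2).
by rewrite addr0.
Qed.

Lemma psiK v w (z : CX v w) : psi_inv (psi z) = z.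
Proof.
case: z => z1 z2; rewrite psiE /psi_inv; congr pair.
  by rewrite linearZ /= pn qinvKV.
case: w z1 z2 => [|w] z1 z2; first exact: shift0.
by rewrite /= linearD linearZ /= p_upsilon1 scaler0 add0r pn.
Qed.

Lemma psi_invE v w (z : HX v w) : psi (psi_inv z)
  = (pi v w z.1, upsilon (pi v w z.1) + shift_map (fun w x => pi v w x) z.2).
Proof.
rewrite psiE; congr pair; first by rewrite /= linearZ /= qinvVK np.
case: w z => [|w] [u x] /=; first exact: (@shift0 k (X v)).
by rewrite np linearZ /= linearZ /= qinvVK np.
Qed.

Lemma pi_upsilon1 v w (x : X v w.+1) : pi v w (upsilon1 x) = 0.
Proof. by rewrite -np p_upsilon1 linear0. Qed.

(** A pair (u, x) is harmonic if and only if u and x - Upsilon(u) are invariant. *)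
Lemma harmonic_succ v w (u : X v w.+1) (x : X v w) :
  @is_harmonic v w.+1 (u, x) <-> t v w.+1 u = u /\ t v w (x - upsilon1 u) = x - upsilon1 u.
Proof.
pose u1 := t v w.+1 u - u; pose x1 := t v w x + d1' u - d1 u - x.
have -> : @is_harmonic v w.+1 (u, x)
    = ((t v w.+1 u1 - u1, t v w x1 + d1' u1 - d1 u1 - x1) = 0 :> HX v w.+1) by [].
have ups_t : t v w (upsilon1 u) = upsilon1 u + (d1 u - pi v w (d1 u)).
  by rewrite -[X in _ + X]opprB -upsilon1_sub_t opprB addrCA subrr addr0.
have pi_t y : pi v w (t v w y) = pi v w y by exact: invp_t.
split=> [[e1 e2]|[tu tx]].
- have tu := invariant_of_sq iota (@t_order v w.+1) e1; split=> //.
  have u10 : u1 = 0 by rewrite /u1 tu subrr.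
  move: e2; rewrite u10 !linear0 !addr0 => /subr0_eq tm.
  have := @invp_invariant _ iota _ (t v w) w _ tm.
  rewrite /x1 addr_regroup linearD !linearB /= pi_t subrr add0r.
  rewrite (@invp_invariant _ iota _ (t v w) w _ (d'_inv tu)) => hpi.
  have e : d1 u - pi v w (d1 u) = t v w x - x.
    by apply: (addIr (d1' u - d1 u)); rewrite -hpi addrC addrA subrK.
  by rewrite ups_t e opprD opprB addrCA [t v w x + _]addrCA subrr addr0 addrC.
- have e : t v w x - x = d1 u - pi v w (d1 u).
    move: tx; rewrite linearB /= ups_t => /(congr1 (fun y => y + upsilon1 u)) /=.
    by rewrite subrK => /addr_cancel.
  have m_inv : t v w (d1' u - pi v w (d1 u)) = d1' u - pi v w (d1 u).
    by rewrite linearB /= d'_inv // t_invp.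
  have -> : x1 = d1' u - pi v w (d1 u).
    rewrite /x1 addr_regroup e; exact: addr_telescope.
  have -> : u1 = 0 by rewrite /u1 tu subrr.
  by rewrite !linear0 !addr0 m_inv subrr.
Qed.

Lemma harmonicP v w (z : HX v w) : is_harmonic z <-> psi (psi_inv z) = z.
Proof.
rewrite psi_invE; case: w z => [|w] [u x] /=.
  have tu : t v 0 u = u by exact: (@t_order v 0).
  split=> _; first by congr pair; [rewrite invp_invariant | exact: (@shift0 k (X v))].
  apply: injective_projections; last exact: (@shift0 k (X v)).
  rewrite -[LHS]/(t v 0 (t v 0 u - u) - (t v 0 u - u)) tu subrr linear0 subrr //.
split=> [/harmonic_succ[tu tx]|].
  congr pair; first by rewrite invp_invariant.
  rewrite (@invp_invariant _ iota _ (t v w.+1) w.+1 _ tu).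
  by have := @invp_invariant _ iota _ (t v w) w _ tx; rewrite linearB /= pi_upsilon1 subr0 => ->;
    rewrite addrC subrK.
case=> e1 e2; apply/harmonic_succ.
have tu : t v w.+1 u = u by rewrite -e1 t_invp.
split=> //; rewrite e1 in e2.
by rewrite -e2 [upsilon1 u + _]addrC addrK t_invp.
Qed.

(** * Compatibility of psi with the three differentials *)

Fact upsilon_linear v w : linear (@upsilon v w).
Proof. by case: w => [|w] c x y; [exact: (@shift0 k (X v)) | exact: upsilon1_linear]. Qed.

Lemma psi_linear v w : linear (@psi v w).
Proof.
move=> c x y; rewrite !psiE; apply: injective_projections.
  rewrite -[LHS]/(q w *: n v w (c *: x.1 + y.1)).
  rewrite -[RHS]/(c *: (q w *: n v w x.1) + q w *: n v w y.1).
  by rewrite linearP scalerDr !scalerA mulrC.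
rewrite -[LHS]/(q w *: upsilon (n v w (c *: x.1 + y.1))
  + shift_map (fun w => n v w : Xb v w -> X v w) (c *: x.2 + y.2)).
rewrite linearP upsilon_linear (shift_map_linear (fun w => linearP (n v w))).
rewrite -[RHS]/(c *: (q w *: upsilon (n v w x.1) + shift_map (fun w => n v w : Xb v w -> X v w) x.2)
 + (q w *: upsilon (n v w y.1) + shift_map (fun w => n v w : Xb v w -> X v w) y.2)).
by rewrite !scalerDr !scalerA (mulrC c) addrACA.
Qed.

Lemma psi_inv_linear v w : linear (@psi_inv v w).
Proof.
move=> c x y; apply: injective_projections.
  rewrite -[LHS]/(w.+1%:R *: p v w (c *: x.1 + y.1)).
  rewrite -[RHS]/(c *: (w.+1%:R *: p v w x.1) + w.+1%:R *: p v w y.1).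
  by rewrite linearP scalerDr !scalerA mulrC.
exact: (shift_map_linear (fun w => linearP (p v w))).
Qed.

Lemma psi_b v w (z : CX v.+1 w) : psi (cb z) = hb (psi z).
Proof.
rewrite !psiE /hb /cb; apply: injective_projections.
  by rewrite /= n_bb linearZ.
case: w z => [|w] [x y]; first exact: (@shift0 k (X v)).
rewrite /= (linearP (b v w)) (linearN (n v w)) !n_bb b_upsilon1 scalerN opprD opprK.
reflexivity.
Qed.

Lemma psi_B v w (z : CX v w) : psi (cB z) = hB (psi z).
Proof.
rewrite !psiE; apply: injective_projections.
  by rewrite /= (linear0 (n v w.+1)) scaler0.
rewrite /= (linear0 (n v w.+1)) (linear0 (@upsilon1 v w)) scaler0 add0r.
rewrite (linear_scale _ _ (norm_linear (t v w) w)) norm_invariant ?t_n //.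
by rewrite qinvVK.
Qed.

Lemma psi_d v w (z : CX v w.+1) : psi (cd z + cxi z) = hd (psi z).
Proof.
case: z => x y; rewrite !psiE; set u := q w.+1 *: n v w.+1 x.
have tu : t v w.+1 u = u by rewrite /u linearZ /= t_n.
have n_dx : q w *: n v w (db1 x) = pi v w (d1 u).
  by rewrite (pi_d tu) n_db /u linearZ scalerA mulrAC [_%:R * _]mulrC qinvK mul1r.
apply: injective_projections.
  rewrite -[LHS]/(q w *: n v w (db1 x + 0)) addr0 n_dx.
  rewrite -[RHS]/(d1 u + (q w.+1 *: upsilon1 (n v w.+1 x) + n v w y
    - t v w (q w.+1 *: upsilon1 (n v w.+1 x) + n v w y))).
  rewrite -(linear_scale _ _ (@upsilon1_linear v w)) -/u linearD /= t_n opprD addrACA subrr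
    addr0 upsilon1_sub_t.
  by rewrite addrC subrK.
rewrite -[LHS]/(q w *: upsilon (n v w (db1 x + 0))
  + shift_map (fun w => n v w : Xb v w -> X v w) (- db y + cxibar x)) addr0.
rewrite -[RHS]/(- d' (q w.+1 *: upsilon1 (n v w.+1 x) + n v w y : X v w)).
rewrite -(linear_scale _ _ (@upsilon1_linear v w)) -/u -(linear_scale _ _ (@upsilon_linear v w))
  n_dx.
have eu : u = q w.+1 *: n v w.+1 x by [].
case: w x y u tu n_dx eu => [|w] x y u tu n_dx eu; first exact: (@shift0 k (X v)).
rewrite -[d' _]/(d1' (upsilon1 u + n v w.+1 y)) linearD opprD (upsilon1_key tu) /=.
rewrite (linearD (n v w)) (linearN (n v w)) -[db y]/(db1 y) n_db.
rewrite (linear_scale _ _ (linearP (n v w))) np.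
have -> : pi v w (d1' (sg v w.+1 (d1 u)))
    = q w.+2 *: pi v w (d1' (sg v w.+1 (d1 (n v w.+2 x)))).
  by rewrite eu (linear_scale _ _ (@d1_linear v w.+1)) (linear_scale _ _ (sig_linear iota _ _))
    (linear_scale _ _ (@d1'_linear v w)) (linear_scale _ _ (invp_linear iota _ _)).
by rewrite [- _ + _]addrC addrA.
Qed.

(** * The double mixed complex of harmonic pairs *)

Lemma harmonic_psi v w (z : CX v w) : is_harmonic (psi z).
Proof. by apply/harmonicP; rewrite psiK. Qed.

Fact hb_linear v w : linear (@hb v w).
Proof.
move=> c x y; apply: injective_projections; first exact: linearP.
rewrite -[LHS]/(- shift_map (fun w => b v w : X v.+1 w -> X v w) (c *: x.2 + y.2)).
by rewrite (shift_map_linear (fun w => linearP (b v w))) opprD -scalerN.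
Qed.

Fact d'_linear v w : linear (@d' v w).
Proof. by case: w => [|w] c x y; [exact: (@shift0 k (X v)) | exact: d1'_linear]. Qed.

Fact hd_linear v w : linear (@hd v w).
Proof.
move=> c x y; apply: injective_projections.
  rewrite -[LHS]/(d1 (c *: x.1 + y.1) + ((c *: x.2 + y.2) - t v w (c *: x.2 + y.2))).
  have e : (c *: x.2 + y.2) - t v w (c *: x.2 + y.2)
      = c *: (x.2 - t v w x.2) + (y.2 - t v w y.2) :> X v w.
    by rewrite (linearP (t v w)) opprD addrACA scalerBr.
  by rewrite d1_linear e addrACA -scalerDr.
rewrite -[LHS]/(- d' (c *: (x.2 : X v w) + y.2)) d'_linear opprD -scalerN //.
Qed.

Fact hB_linear v w : linear (@hB v w).
Proof.
move=> c x y; apply: injective_projections; last exact: norm_linear.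
by rewrite -[RHS]/(c *: 0 + 0) scaler0 addr0.
Qed.

Lemma hb_hb v w (z : HX v.+2 w) : hb (hb z) = 0.
Proof.
apply: injective_projections; first exact: b_b.
case: w z => [|w] z; first exact: (@shift0 k (X v)).
by rewrite -[LHS]/(- b v w (- b v.+1 w z.2)) linearN opprK b_b.
Qed.

Fact d1D v w (x y : X v w.+1) : d1 (x + y) = d1 x + d1 y.
Proof. by rewrite linearD. Qed.

Fact d1B v w (x y : X v w.+1) : d1 (x - y) = d1 x - d1 y.
Proof. by rewrite linearB. Qed.

Fact d1'N v w (x : X v w.+1) : d1' (- x) = - d1' x. Proof. by rewrite linearN. Qed.

Lemma hd_hd v w (z : HX v w.+2) : hd (hd z) = 0.
Proof.
apply: injective_projections.
  rewrite -[LHS]/(d1 (d1 z.1 + (z.2 - t v w.+1 z.2)) + (- d1' z.2 - t v w (- d1' z.2))).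
  rewrite d1D d_d add0r d1B d_t (linearN (t v w)) opprK.
  exact: addr_cancel4.
case: w z => [|w] z; first exact: (@shift0 k (X v)).
by rewrite -[LHS]/(- d1' (- d1' z.2)) d1'N opprK d'_d'.
Qed.

Lemma hB_hB v w (z : HX v w) : hB (hB z) = 0.
Proof.
by apply: injective_projections; [| rewrite -[LHS]/(N v w.+1 0) linear0].
Qed.

Lemma hd_hb v w (z : HX v.+1 w.+1) : hd (hb z) + hb (hd z) = 0.
Proof.
apply: injective_projections.
  rewrite -[LHS]/(d1 (b v w.+1 z.1) + (- b v w z.2 - t v w (- b v w z.2))
                  + b v w (d1 z.1 + (z.2 - t v.+1 w z.2))).
  rewrite (linearD (b v w)) (linearB (b v w)) /= bt (linearN (t v w)) opprK.
  rewrite addrACA (addrC (d1 _)) b_d add0r addrACA addNr add0r; exact: subrr.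
case: w z => [|w] z; first exact: (@shift0 k (X v)).
rewrite -[LHS]/(- d1' (- b v w.+1 z.2) + - b v w (- d1' z.2)).
by rewrite d1'N (linearN (b v w)) !opprK addrC b_d'.
Qed.

Lemma hd_hB v w (z : HX v w.+1) : hd (hB z) + hB (hd z) = 0.
Proof.
apply: injective_projections.
  rewrite -[LHS]/(d1 0 + (N v w.+1 z.1 - t v w.+1 (N v w.+1 z.1)) + 0).
  by rewrite linear0 t_norm // subrr !addr0.
rewrite -[LHS]/(- d1' (N v w.+1 z.1) + N v w (d1 z.1 + (z.2 - t v w z.2))).
rewrite d'_norm (linearD (norm (t v w) w)) (linearB (norm (t v w) w)) /= norm_t //.
by rewrite subrr addr0 addNr.
Qed.

Lemma hd_hB0 v (z : HX v 0) : hd (hB z) = 0.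
Proof.
apply: injective_projections; last exact: (@shift0 k (X v)).
rewrite -[LHS]/(d1 0 + (N v 0 z.1 - t v 0 (N v 0 z.1))).
by rewrite linear0 t_norm // subrr addr0.
Qed.

Lemma hb_hB v w (z : HX v.+1 w) : hb (hB z) + hB (hb z) = 0.
Proof.
have b_norm x : b v w (N v.+1 w x) = N v w (b v w x).
  rewrite /norm linear_sum; apply: eq_bigr => l _ /=.
  by elim: (nat_of_ord l) => //= i IH; rewrite bt IH.
apply: injective_projections; first by rewrite -[LHS]/(b v w.+1 0 + 0) linear0 addr0.
by rewrite -[LHS]/(- b v w (N v.+1 w z.1) + N v w (b v w z.1)) b_norm addNr.
Qed.

Lemma harmonic_stable v w v' w' (F : HX v w -> HX v' w') (G : CX v w -> CX v' w') :
  (forall z, psi (G z) = F (psi z)) -> forall z, is_harmonic z -> is_harmonic (F z).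
Proof. by move=> FG z /harmonicP <-; rewrite -FG; exact: harmonic_psi. Qed.

Lemma harmonic_dmcP : is_double_mixed_complex harmonic_dmc.
Proof.
split=> /=.
- move=> v w; split=> [|c x y /harmonicP hx /harmonicP hy]; apply/harmonicP.
    by rewrite (linear_zero (@psi_inv_linear v w)) (linear_zero (@psi_linear v w)).
  by rewrite psi_inv_linear psi_linear hx hy.
- move=> v w; split; last by move=> c x y _ _; exact: hb_linear.
  exact: (harmonic_stable (@psi_b v w)).
- move=> v w; split; last by move=> c x y _ _; exact: hd_linear.
  exact: (harmonic_stable (@psi_d v w)).
- move=> v w; split; last by move=> c x y _ _; exact: hB_linear.
  exact: (harmonic_stable (@psi_B v w)).
- by move=> v w x _; exact: hb_hb.
- by move=> v w x _; exact: hd_hd.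
- by move=> v w x _; exact: hB_hB.
- by move=> v w x _; exact: hd_hb.
- by move=> v w x _; exact: hd_hB.
- by move=> v x _; exact: hd_hB0.
- by move=> v w x _; exact: hb_hB.
Qed.

Lemma psi_morphism : is_dmc_morphism (Y := coinvariant_dmc) (Z := harmonic_dmc) psi.
Proof.
split=> /=.
- move=> v w; split=> [x _|c x y _ _]; [exact: harmonic_psi | exact: psi_linear].
- by move=> v w x _; exact: psi_b.
- by move=> v w x _; exact: psi_d.
- by move=> v w x _; exact: psi_B.
Qed.

Theorem harmonic_isomorphism :
  is_double_mixed_complex coinvariant_dmc /\ is_double_mixed_complex harmonic_dmc /\
  is_dmc_isomorphism (Y := coinvariant_dmc) (Z := harmonic_dmc) psi.
Proof.
have gl v w : linear_on (@sub k harmonic_dmc v w) (@sub k coinvariant_dmc v w) (@psi_inv v w).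
  by split=> // c x y _ _; exact: psi_inv_linear.
have sub_all v w x : @sub k coinvariant_dmc v w x by [].
split; last split.
- exact: (@transport_dmc k coinvariant_dmc harmonic_dmc psi psi_inv harmonic_dmcP sub_all
  psi_morphism gl psiK).
- exact: harmonic_dmcP.
- apply: (@transport_iso k coinvariant_dmc harmonic_dmc psi psi_inv sub_all psi_morphism gl
  psiK) => v w x.
  by move/harmonicP.
Qed.

End Harmonic.

(** * Coinvariants of tensors *)

Section Coinvariants.
Variables (k : comNzRingType) (iota : {rmorphism rat -> k}).
Variables (A : algType k) (M : bimodule A).
Variables (tri : M -> M -> M) (K : {pred A}).
Hypothesis htri : assoc_product tri.

Notation X := (X M K).

Lemma clX_linear v w : linear (@clX k A M K v w).
Proof. by move=> c x y; rewrite /clX class_ofD class_ofZ. Qed.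

Lemma clX_surj v w (z : Xbar M K v w) : exists x, z = clX x.
Proof. exact: class_of_surj. Qed.

(** A linear map that is invariant under t factors through the coinvariants. *)
Lemma lifted_clX v w (Y : lmodType k) (f : X v w -> Y) : linear f ->
  (forall x, f (tX x) = f x) -> forall x, f (lifted (clX x)) = f x.
Proof.
move=> lf ft x; have fB y z : f (y - z) = f y - f z by exact: linear_subE.
apply/eqP; rewrite -subr_eq0 -fB; apply/eqP.
elim: (@repr_class_of _ _ (@coinv_rel k A M K v w) x) => [|c y z [u ->] _ IH].
  exact: linear_zero lf.
by rewrite lf fB ft subrr scaler0 add0r.
Qed.

Lemma clX_tX v w (x : X v w) : clX (tX x) = clX x.
Proof.
apply: class_of_eq; rewrite -opprB -[- _]scaleN1r -[_ *: _]addr0.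
by apply: Defs.span_cons; [exists x | exact: Defs.span0].
Qed.

Lemma Nbar_clX v w (x : X v w) : Nbar (clX x) = NX x.
Proof. exact: (lifted_clX (@NX_linear k A M K v w) (@NX_tX k A M K v w)). Qed.

Lemma Nbar_linear v w : linear (@Nbar k A M K v w).
Proof.
move=> c z z'; have [x ->] := clX_surj z; have [x' ->] := clX_surj z'.
by rewrite -clX_linear !Nbar_clX NX_linear.
Qed.

Lemma frak_p_linear v w : linear (@frak_p k iota A M K v w).
Proof. by move=> c x y; rewrite /frak_p clX_linear scalerDr !scalerA mulrC. Qed.

Lemma Nbar_frak_p v w (x : X v w) : Nbar (frak_p iota x) = qinv iota w *: NX x.
Proof.
by rewrite /frak_p (linear_scale _ _ (@Nbar_linear v w)) Nbar_clX.
Qed.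

Lemma clX_NX v w (x : X v w) : clX (NX x) = w.+1%:R *: clX x.
Proof.
rewrite /NX (linear_big _ (@clX_linear v w)) (eq_bigr (fun=> clX x)).
  by rewrite sumr_const card_ord scaler_nat.
by move=> l _; elim: (nat_of_ord l) => //= i IH; rewrite clX_tX.
Qed.

Lemma frak_p_Nbar v w (z : Xbar M K v w) : frak_p iota (Nbar z) = z.
Proof.
have [x ->] := clX_surj z; rewrite Nbar_clX /frak_p clX_NX.
exact: qinvVK.
Qed.

Lemma dX_sub_tX v w (x : X v w.+1) :
  (dX tri x : X v w) - dX tri (tX x) = (dX' tri x : X v w) - tX (dX' tri x : X v w).
Proof. exact: addr_common (dX_eq htri x) (dX_tX htri x). Qed.

Lemma bX_NX v w (x : X v.+1 w) : bX (NX x) = NX (bX x).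
Proof.
rewrite /NX (linear_big _ (@bX_linear k A M K v w)); apply: eq_bigr => l _.
by elim: (nat_of_ord l) => //= i IH; rewrite bX_tX IH.
Qed.

Lemma Nbar_bbar v w (z : Xbar M K v.+1 w) : Nbar (bbar z) = bX (Nbar z).
Proof.
have [x ->] := clX_surj z.
rewrite /bbar (lifted_clX (f := fun x => clX (bX x))).
- by rewrite !Nbar_clX bX_NX.
- exact: (linear_comp (@clX_linear v w) (@bX_linear k A M K v w)).
- by move=> y; rewrite bX_tX clX_tX.
Qed.

Lemma dX'_NX v w (x : X v w.+1) : dX' tri (NX x) = NX (dX tri x : X v w) :> X v w.
Proof.
exact: (norm_commutation iota (s := linear_bundle (@tX_linear k A M K v w.+1))
  (t := linear_bundle (@tX_linear k A M K v w)) (@e0X_linear k A M tri K htri v w)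
  (@tX_order k A M K v w.+1) (@tX_order k A M K v w)
  (@dX_eq k A M tri K htri v w) (@dX_tX k A M tri K htri v w)
  (@NX_dX_e0X k A M tri K htri v w)).
Qed.

Lemma Nbar_dbar v w (z : Xbar M K v w.+1) : Nbar (dbar tri z : Xbar M K v w) = dX' tri (Nbar z).
Proof.
have [x ->] := clX_surj z.
have lf : linear (fun x : X v w.+1 => clX (dX tri x : X v w)).
  exact: (linear_comp (@clX_linear v w) (@dX_linear k A M tri K htri v w)).
have := lifted_clX (f := fun x : X v w.+1 => clX (dX tri x : X v w)) lf.
rewrite -[dbar tri _]/(clX (dX tri (lifted (clX x)) : X v w)) => ->.
  by rewrite !Nbar_clX dX'_NX.
move=> y; apply/esym/subr0_eq; rewrite -(linear_subE _ _ (@clX_linear v w)).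
rewrite dX_sub_tX (linear_subE _ _ (@clX_linear v w)) clX_tX; exact: subrr.
Qed.

Lemma bX_dX' v w (x : X v.+1 w.+1) :
  bX (dX' tri x : X v.+1 w) + dX' tri (bX x) = 0 :> X v w.
Proof.
have e1 := bX_dX htri x; rewrite (dX_eq htri x) (dX_eq htri (bX x)) in e1.
rewrite (linear_addE _ _ (@bX_linear k A M K v w)) in e1.
have e2 := bX_e0X htri (tX x); rewrite bX_tX in e2.
exact: addr_split0 e1 e2.
Qed.

End Coinvariants.

Theorem theorem3p9 (k : comNzRingType) (iota : {rmorphism rat -> k})
    (A : algType k) (M : bimodule A) (tri : M -> M -> M) (K : {pred A})
    (htri : assoc_product tri) (hK : GRing.subalg_closed K) :
  is_double_mixed_complex (Xtilde iota tri K) /\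
  is_double_mixed_complex (PXdd tri K) /\
  is_dmc_isomorphism (Y := Xtilde iota tri K) (Z := PXdd tri K)
    (@Psi _ iota _ _ tri K).
Proof.
(* The maps of the statement are the abstract ones by unfolding. *)
have H := @harmonic_isomorphism k iota (X M K) (Xbar M K)
  (fun v w => linear_bundle (@tX_linear k A M K v w))
  (fun v w => linear_bundle (@bX_linear k A M K v w))
  (@dX k A M tri K) (@dX' k A M tri K)
  (fun v w => linear_bundle (@frak_p_linear k iota A M K v w))
  (fun v w => linear_bundle (@Nbar_linear k A M K v w))
  (@bbar k A M K) (@dbar k A M tri K)
  (@dX_linear k A M tri K htri) (@dX'_linear k A M tri K htri)
  (@tX_order k A M K) (@bX_tX k A M K) (@bX_bX k A M K)
  (@dX_dX k A M tri K htri) (@dX'_dX' k A M tri K htri)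
  (@bX_dX k A M tri K htri) (@bX_dX' k A M tri K htri)
  (@dX_sub_tX k A M tri K htri) (@dX'_NX k iota A M tri K htri)
  (@frak_p_Nbar k iota A M K) (@Nbar_frak_p k iota A M K)
  (@Nbar_bbar k A M K) (@Nbar_dbar k iota A M tri K htri).
exact: H.
Qed.
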